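(* Suppose that $G$ is consistent and positive definite. (a) Every function $f\in\mathcal F^+$ such that $c^*(f)<+\infty$ has a majorant of class $\mathcal H_0^*$. If moreover $f$ is quasi u.s.c. then $f\in\mathcal H_0^*$. (b) Every set $A\subset X$ such that $c^*(A)<+\infty$ is contained in some quasicompact set. If moreover $A$ is quasiclosed then $A$ is quasicompact.
   Context: $X$ is a nonempty locally compact Hausdorff space, $\mathcal M^+$ the set of positive Radon measures on $X$ with the vague topology (coarsest topology making $\mu\mapsto\int\varphi\,d\mu$ continuous for every continuous compactly supported $\varphi$). $G:X\times X\to[0,+\infty]$ is a kernel: lower semicontinuous (l.s.c.), symmetric, and $G(x,x)>0$ for all $x$. For $\mu\in\mathcal M^+$: $G\mu(x)=\int G(x,y)\,d\mu(y)$, $\|\mu\|=(\int G\mu\,d\mu)^{1/2}$; $\mathcal E^+=\{\mu\in\mathcal M^+:\|\mu\|<+\infty\}$, $\mathcal E^+_1=\{\mu\in\mathcal M^+:\|\mu\|\le1\}$. $\mathcal F^+$: all functions $X\to[0,+\infty]$. $\mathcal G$: l.s.c. functions in $\mathcal F^+$. $\mathcal H_0$: finite-valued upper semicontinuous (u.s.c.) functions $X\to[0,+\infty[$ of compact support. $\mathcal C_0^+=\mathcal G\cap\mathcal H_0$. Energy capacity: $c(\varphi)=\max\{\int\varphi\,d\mu:\mu\in\mathcal E_1^+\}$ for $\varphi\in\mathcal C_0^+$; $c(g)=\sup\{c(\varphi):\varphi\in\mathcal C_0^+,\varphi\le g\}$ for $g\in\mathcal G$; $c^*(f)=\inf\{c(g):g\in\mathcal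 G,g\ge f\}$ for $f\in\mathcal F^+$; $c^*(E)=c^*(1_E)$ for $E\subset X$. $\mathcal H_0^*$: the set of $f\in\mathcal F^+$ with $\inf\{c^*(f-h):h\in\mathcal H_0,h\le f\}=0$. A function $f\in\mathcal F^+$ is quasi u.s.c. if for every $\varepsilon>0$ there is a set $V\subset X$ (which may be taken open) with $c^*(V)<\varepsilon$ such that $f|_{X\setminus V}$ is u.s.c. A set $A\subset X$ is quasicompact (resp. quasiclosed) if $\inf\{c^*(A\setminus K)\}=0$, the infimum being over compact (resp. closed) sets $K\subset A$; $A$ is quasiclosed iff $1_A$ is quasi u.s.c. $G$ is consistent if for every $\lambda\in\mathcal E^+$ the function $\mu\mapsto\int G\lambda\,d\mu$ on $\mathcal E^+_1$ is finite and vaguely continuous (equivalently $G\lambda\in\mathcal H_0^*$ for every $\lambda\in\mathcal E^+$). $G$ is positive definite if $\int G\mu\,d\nu\le\|\mu\|\,\|\nu\|$ for all $\mu,\nu\in\mathcal E^+$. *)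

(* Defs.v *)
From HB Require Import structures.
From mathcomp Require Import all_boot all_order all_algebra.
From mathcomp Require Import all_classical all_reals.
From mathcomp Require Import topology ereal normedtype exp numfun.

Set Implicit Arguments.
Unset Strict Implicit.
Unset Printing Implicit Defensive.

Import Order.TTheory GRing.Theory Num.Theory.
Import numFieldNormedType.Exports.

Local Open Scope classical_set_scope.
Local Open Scope ring_scope.

Definition closed_support {X : topologicalType} {V : nmodType} (f : X -> V) :
  set X := closure [set x | f x != 0].

Definition Cc_pred {X : topologicalType} {R : realType} : {pred X -> R} :=
  fun f => `[< continuous f /\ compact (closed_support f) >].

Lemma Cc_pred_submod {X : topologicalType} {R : realType} :
  submod_closed (@Cc_pred X R).
Proof.
split.
  apply/asboolP; split; first by move=> x; exact: cst_continuous.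
  rewrite /closed_support (_ : [set x | _] = set0) ?closure0.
    exact: compact0.
  by apply/seteqP; split => x //=; rewrite eqxx.
move=> a f g /asboolP[cf kf] /asboolP[cg kg]; apply/asboolP; split.
  move=> x; apply: (@continuousD R) (cg x).
  exact: (continuousM (@cst_continuous _ _ a x) (cf x)).
apply: (subclosed_compact _ (compactU kf kg)); first exact: closed_closure.
rewrite /closed_support -closureU; apply: closure_subset => x /=.
have [fx0|] := eqVneq (f x) 0; last by left.
have [gx0|] := eqVneq (g x) 0; last by right.
by rewrite !fctE fx0 gx0 scaler0 addr0 eqxx.
Qed.

HB.instance Definition _ {X : topologicalType} {R : realType} :=
  GRing.isSubmodClosed.Build R (X -> R) (@Cc_pred X R) Cc_pred_submod.

Record Cc (X : topologicalType) (R : realType) := MkCc {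
  Cc_fun :> X -> R;
  _ : Cc_fun \in Cc_pred }.

HB.instance Definition _ (X : topologicalType) (R : realType) :=
  [isSub for @Cc_fun X R].
HB.instance Definition _ (X : topologicalType) (R : realType) :=
  [Choice of Cc X R by <:].
HB.instance Definition _ (X : topologicalType) (R : realType) :=
  [SubChoice_isSubLmodule of Cc X R by <:].

(* Following Bourbaki, a positive Radon measure on a locally compact Hausdorff
   space is a positive linear form on the space of continuous functions of
   compact support. *)
Record radon (X : topologicalType) (R : realType) := Radon {
  radon_fun :> Cc X R -> R;
  radon_scalar : scalar radon_fun;
  radon_ge0 : forall phi : Cc X R,
    (forall x, 0 <= phi x) -> 0 <= radon_fun phi }.

HB.instance Definition _ (X : topologicalType) (R : realType) :=
  gen_eqMixin (radon X R).
HB.instance Definition _ (X : topologicalType) (R : realType) :=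
  gen_choiceMixin (radon X R).

(* Vague topology. *)
HB.instance Definition _ (X : topologicalType) (R : realType) :=
  Topological.copy (radon X R)
    (initial_topology (fun mu : radon X R => (mu : {ptws Cc X R -> R}))).

Local Open Scope ereal_scope.

(* On [subspace A], upper semicontinuity is that of the restriction to A, the
   points outside A being isolated in [subspace A]. *)
Definition upper_semicontinuous {X : topologicalType} {R : realType}
    (f : X -> \bar R) :=
  forall x a, f x < a%:E -> exists2 V, nbhs x V & forall y, V y -> f y < a%:E.

Definition fun_le {X : Type} {R : realType} (f g : X -> \bar R) :=
  forall x, f x <= g x.

Definition Fplus {X : topologicalType} {R : realType} : set (X -> \bar R) :=
  [set f | forall x, 0 <= f x].

Definition Glsc {X : topologicalType} {R : realType} : set (X -> \bar R) :=
  [set g | Fplus g /\ lower_semicontinuous g].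

Definition Hzero {X : topologicalType} {R : realType} : set (X -> \bar R) :=
  [set h | [/\ Fplus h, forall x, h x < +oo, upper_semicontinuous h &
               compact (closed_support h)]].

Definition C0plus {X : topologicalType} {R : realType} : set (X -> \bar R) :=
  Glsc `&` Hzero.

(* Bourbaki's integral of positive functions: first for l.s.c. functions, then
   the upper integral of an arbitrary function in [Fplus]. The two agree on
   l.s.c. functions, and every integrand below is l.s.c. *)
Definition radon_integral_lsc {X : topologicalType} {R : realType}
    (mu : radon X R) (g : X -> \bar R) : \bar R :=
  ereal_sup [set (mu phi)%:E | phi in [set phi : Cc X R |
    forall x, (0 <= phi x)%R /\ (phi x)%:E <= g x]].

Definition radon_integral {X : topologicalType} {R : realType}
    (mu : radon X R) (f : X -> \bar R) : \bar R :=
  ereal_inf [set radon_integral_lsc mu g | g in [set g | Glsc g /\ fun_le f g]].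

Definition is_kernel {X : topologicalType} {R : realType}
    (G : X * X -> \bar R) :=
  [/\ forall z, 0 <= G z, lower_semicontinuous G,
      forall x y, G (x, y) = G (y, x) & forall x, 0 < G (x, x)].

Definition potential {X : topologicalType} {R : realType}
    (G : X * X -> \bar R) (mu : radon X R) : X -> \bar R :=
  fun x => radon_integral mu (fun y => G (x, y)).

Definition energy_norm {X : topologicalType} {R : realType}
    (G : X * X -> \bar R) (mu : radon X R) : \bar R :=
  sqrte (radon_integral mu (potential G mu)).

Definition Eplus {X : topologicalType} {R : realType}
    (G : X * X -> \bar R) : set (radon X R) :=
  [set mu | energy_norm G mu < +oo].

Definition Eplus1 {X : topologicalType} {R : realType}
    (G : X * X -> \bar R) : set (radon X R) :=
  [set mu | energy_norm G mu <= 1].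

(* The supremum is attained when f is in [C0plus]. *)
Definition cap_C0 {X : topologicalType} {R : realType}
    (G : X * X -> \bar R) (f : X -> \bar R) : \bar R :=
  ereal_sup [set radon_integral mu f | mu in Eplus1 G].

Definition cap_lsc {X : topologicalType} {R : realType}
    (G : X * X -> \bar R) (g : X -> \bar R) : \bar R :=
  ereal_sup [set cap_C0 G phi | phi in [set phi | C0plus phi /\ fun_le phi g]].

Definition outer_cap {X : topologicalType} {R : realType}
    (G : X * X -> \bar R) (f : X -> \bar R) : \bar R :=
  ereal_inf [set cap_lsc G g | g in [set g | Glsc g /\ fun_le f g]].

Definition outer_cap_set {X : topologicalType} {R : realType}
    (G : X * X -> \bar R) (E : set X) : \bar R :=
  outer_cap G (fun x => (\1_E x)%:E).

Definition Hzero_star {X : topologicalType} {R : realType}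
    (G : X * X -> \bar R) : set (X -> \bar R) :=
  [set f | Fplus f /\
    ereal_inf [set outer_cap G (fun x => f x - h x) |
               h in [set h | Hzero h /\ fun_le h f]] = 0].

Definition quasi_usc {X : topologicalType} {R : realType}
    (G : X * X -> \bar R) (f : X -> \bar R) :=
  forall e : R, (0 < e)%R -> exists V : set X,
    outer_cap_set G V < e%:E /\
    upper_semicontinuous (f : subspace (~` V) -> \bar R).

Definition quasicompact {X : topologicalType} {R : realType}
    (G : X * X -> \bar R) (A : set X) :=
  ereal_inf [set outer_cap_set G (A `\` K) |
             K in [set K | compact K /\ K `<=` A]] = 0.

Definition quasiclosed {X : topologicalType} {R : realType}
    (G : X * X -> \bar R) (A : set X) :=
  ereal_inf [set outer_cap_set G (A `\` K) |
             K in [set K | closed K /\ K `<=` A]] = 0.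

Definition consistent {X : topologicalType} {R : realType}
    (G : X * X -> \bar R) :=
  forall lambda : radon X R, Eplus G lambda ->
    (forall mu, Eplus1 G mu -> radon_integral mu (potential G lambda) < +oo) /\
    {within Eplus1 G,
      continuous (fun mu : radon X R => radon_integral mu (potential G lambda))}.

Definition positive_definite {X : topologicalType} {R : realType}
    (G : X * X -> \bar R) :=
  forall mu nu : radon X R, Eplus G mu -> Eplus G nu ->
    radon_integral nu (potential G mu) <= energy_norm G mu * energy_norm G nu.

(* Main.v *)
Require Import Defs.
From mathcomp Require Import all_boot all_order all_algebra.
From mathcomp Require Import all_classical all_reals.
From mathcomp Require Import topology ereal normedtype numfun.
From mathcomp Require Import ring lra.

Set Implicit Arguments.
Unset Strict Implicit.
Unset Printing Implicit Defensive.

Import Order.TTheory GRing.Theory Num.Theory.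
Import numFieldNormedType.Exports.

Local Open Scope classical_set_scope.
Local Open Scope ring_scope.

(** Write [Lint mu g] for the integral of a positive l.s.c. function, the
    supremum of [mu phi] over continuous [phi] of compact support with
    [0 <= phi <= g].  For l.s.c. [g] the outer capacity is the supremum of
    [Lint mu g] over the measures [mu] of energy at most 1, so every estimate
    of a capacity below is an estimate of integrals that is uniform over this
    energy ball.

    The energy ball is vaguely compact ([Eplus1_compact]): [G (x, x) > 0] and
    lower semicontinuity bound its measures near each point, and energy is
    vaguely l.s.c.  The latter, together with the symmetry of the mutual energy,
    comes from approximating an iterated integral of [G] from below by finite
    sums [sum_i p_i(x) q_i(y) <= G (x, y)] ([tensor_approx]), for which the
    order of integration plainly does not matter.

    Majorants.  Let [g >= f] be l.s.c. with
    [M = sup {Lint mu g : mu in Eplus1 G}] finite.  A measure [mu] that nearly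
    attains [M] nearly satisfies the variational inequality
    [Lint nu g <= M * mutual energy of mu and nu] for all [nu] in the ball
    ([near_maximizer_ineq], obtained by perturbing [mu] towards [nu]).
    The right side is vaguely continuous in [mu] by consistency, so a cluster
    point of near-maximizers satisfies the inequality exactly.  Rescaled by [M],
    it is a measure [lambda] of finite energy whose potential [p] dominates [g]
    when integrated against any measure of the ball ([dominating_measure]).

    On the compact ball the continuous function [mu |-> Lint mu p] is the
    supremum of the continuous functions [mu |-> mu phi], [phi <= p]; Dini's
    theorem gives a [phi] with [Lint mu p <= mu phi + e] throughout the ball
    ([potential_dini]).  Hence [Lint mu g <= mu phi + e] too, and since the ball
    is stable under multiplying measures by densities between 0 and 1, the
    positive parts of [p - phi] and of [g - phi] have integral at most [e]
    ([Lint_subpos]).  These positive parts are l.s.c., so their capacity is at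
    most [e]; this shows that [max g p], which majorizes [f], is in
    [Hzero_star G].

    The other claims transfer such a majorant [g].  For a quasi u.s.c.
    [f <= g], cut [f] by a function [h0] of [Hzero] close to [g], and by 0 on a
    small open set off which [f] is u.s.c.  For a set [A] of finite capacity
    take [g >= 1_A]; the superlevel set [{g >= 1}] is quasicompact, since [g] is
    a uniform limit of functions of [Hzero] off an open set of small capacity.
    A quasiclosed set inside a quasicompact one is quasicompact by
    intersecting the approximating closed and compact sets. *)

(** * Compactness and continuous functions of compact support *)

(** If [P] fails on [K], the sets [A] such that [P (K `\` A)] form a proper
    filter, which has no cluster point in [K].  Used in place of finite
    subcovers: what is built near each point only has to be glued for two
    sets. *)
Lemma compact_induction (X : topologicalType) (P : set X -> Prop) (K : set X) :
  P set0 -> (forall A B, A `<=` B -> P B -> P A) ->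
  (forall A B, P A -> P B -> P (A `|` B)) ->
  compact K -> (forall x, K x -> exists2 V, nbhs x V & P V) -> P K.
Proof.
move=> P0 PS PU cK PV; apply: contrapT => nPK.
pose F : set_system X := [set A | P (K `\` A)].
have FF : Filter F.
  split; first by rewrite /F /= setDT.
    by move=> A B FA FB; rewrite /F /= setDIr; exact: PU.
  by move=> A B AB FA; apply: (PS _ _ _ FA); exact: setDS.
have PF : ProperFilter F by split=> //; rewrite /F /= setD0.
have FK : F K by rewrite /F /= setDv.
have [x [Kx clx]] := cK F PF FK.
have [V Vx PVV] := PV x Kx.
have FV : F (~` V) by apply: (PS _ V) => // y [_ /contrapT].
by have [y []] := clx _ _ FV Vx.
Qed.

Lemma continuous_maxr (X : topologicalType) (R : realType) (f g : X -> R) :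
  continuous f -> continuous g -> continuous (fun x => Num.max (f x) (g x)).
Proof. by move=> cf cg x; exact: (@continuous_max R X f g x (cf x) (cg x)). Qed.

Section Cc_toolkit.
Context {X : topologicalType} {R : realType}.
Implicit Types phi psi : Cc X R.

Lemma Cc_continuous phi : continuous (phi : X -> R).
Proof. by case: phi => f /= /asboolP[]. Qed.

Lemma Cc_near_gt phi x (a : R) : a < phi x -> nbhs x [set y | a < phi y].
Proof.
move=> h; have /(_ [set z | a < z]) := @Cc_continuous phi x; apply.
by apply: open_nbhs_nbhs; split; first exact: open_gt.
Qed.

Lemma Cc_near_lt phi x (a : R) : phi x < a -> nbhs x [set y | phi y < a].
Proof.
move=> h; have /(_ [set z | z < a]) := @Cc_continuous phi x; apply.
by apply: open_nbhs_nbhs; split; first exact: open_lt.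
Qed.

Lemma Cc_compact phi : compact (closed_support (phi : X -> R)).
Proof. by case: phi => f /= /asboolP[]. Qed.

Lemma Cc_support phi x : phi x != 0 -> closed_support (phi : X -> R) x.
Proof. by move=> px; exact: subset_closure. Qed.

Lemma Cc_build (f : X -> R) (K : set X) : continuous f -> compact K ->
  closed K -> (forall x, f x != 0 -> K x) -> exists phi : Cc X R, phi =1 f.
Proof.
move=> cf cK clK fK.
have fP : f \in Cc_pred.
  apply/asboolP; split=> //; apply: (subclosed_compact _ cK).
    exact: closed_closure.
  by move/closure_id: clK => ->; apply: closure_subset => x /fK.
by exists (MkCc fP).
Qed.

(** The way to build new members of [Cc X R] from old ones: continuity is
    enough when the support does not grow. *)
Lemma Cc_cut phi (f : X -> R) : continuous f ->
  (forall x, phi x = 0 -> f x = 0) -> exists psi : Cc X R, psi =1 f.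
Proof.
move=> cf f0; apply: (Cc_build cf (@Cc_compact phi)).
  exact: closed_closure.
move=> x fx; apply: Cc_support; apply: contraNneq fx => p0.
by rewrite f0.
Qed.

Lemma CcD phi psi x : (phi + psi) x = phi x + psi x.
Proof. by []. Qed.
Lemma CcZ (a : R) phi x : (a *: phi) x = a * phi x.
Proof. by []. Qed.
Lemma Cc_sum I (s : seq I) (F : I -> Cc X R) x :
  (\sum_(i <- s) F i) x = \sum_(i <- s) F i x.
Proof. by elim/big_rec2: _ => // i a b _ <-. Qed.

Lemma Cc_mul (f : X -> R) phi : continuous f ->
  exists psi : Cc X R, forall x, psi x = f x * phi x.
Proof.
move=> cf; apply: (@Cc_cut phi (fun x => f x * phi x)).
  by move=> x; apply: continuousM; [exact: cf|exact: Cc_continuous].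
by move=> x ->; rewrite mulr0.
Qed.

Lemma Cc_max phi psi :
  exists chi : Cc X R, forall x, chi x = Num.max (phi x) (psi x).
Proof.
have c : continuous (fun x => Num.max (phi x) (psi x)).
  by apply: continuous_maxr; exact: Cc_continuous.
apply: (Cc_build c (compactU (@Cc_compact phi) (@Cc_compact psi))).
  by apply: closedU; exact: closed_closure.
move=> x h; have [p0|] := eqVneq (phi x) 0; last by left; exact: Cc_support.
by right; apply: Cc_support; apply: contraNneq h => q0; rewrite p0 q0 maxxx.
Qed.

Lemma Cc_subpos phi (e : R) : 0 <= e ->
  exists chi : Cc X R, forall x, chi x = Num.max (phi x - e) 0.
Proof.
move=> e0; apply: (@Cc_cut phi (fun x => Num.max (phi x - e) 0)).
  apply: continuous_maxr => x; last exact: cst_continuous.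
  by apply: continuousB; [exact: Cc_continuous|exact: cst_continuous].
by move=> x ->; rewrite sub0r; apply/max_idPr; rewrite oppr_le0.
Qed.

Hypothesis hX : hausdorff_space X.
Hypothesis lX : locally_compact [set: X].

(** A locally compact Hausdorff space is completely regular; separating [x]
    from the complement of a neighbourhood with compact closure gives compact
    support. *)
Lemma Cc_bump (x : X) (U : set X) : nbhs x U ->
  exists p : Cc X R, [/\ forall y, 0 <= p y <= 1, p x = 1 &
                         forall y, p y != 0 -> U y].
Proof.
move=> Ux; have [C Cx [cC clC]] := @lX x I; move: Cx; rewrite withinET => Cx.
have Vx : nbhs x (U `&` C)° by apply: nbhs_interior; exact: filterI.
pose B := ~` (U `&` C)°.
have clB : closed B by apply: open_closedC; exact: open_interior.
have nBx : ~ B x by apply; exact: nbhs_singleton.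
have /(@uniform_separatorP _ R)[f [cf f01 fx fB]] :=
  @locally_compact_completely_regular X R lX hX x B clB nBx.
have cg : continuous (fun y => 1 - f y).
  by move=> y; apply: continuousB; [exact: cst_continuous|exact: cf].
have gV y : 1 - f y != 0 -> (U `&` C) y.
  move=> gy; apply: interior_subset; apply: contrapT => By.
  move: gy; have -> : f y = 1 by apply: fB; exists y.
  by rewrite subrr eqxx.
have [p pE] : exists p : Cc X R, p =1 (fun y => 1 - f y).
  by apply: (Cc_build cg cC clC) => y /gV[].
exists p; split.
- move=> y; have : range f (f y) by exists y.
  move=> /f01; rewrite /= in_itv /= => /andP[h0 h1].
  by rewrite pE; apply/andP; split; lra.
- rewrite pE; have -> : f x = 0 by apply: fx; exists x.
  by rewrite subr0.
- by move=> y; rewrite pE => /gV[].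
Qed.

Lemma Cc_ge1 (K : set X) : compact K ->
  exists chi : Cc X R, (forall x, 0 <= chi x) /\ forall x, K x -> 1 <= chi x.
Proof.
move=> cK; pose P A := exists chi : Cc X R,
  (forall x, 0 <= chi x) /\ forall x, A x -> 1 <= chi x.
apply: (@compact_induction _ P) cK _.
- by exists 0; split.
- by move=> A B AB [c [c0 c1]]; exists c; split=> // x /AB; exact: c1.
- move=> A B [a [a0 a1]] [b [b0 b1]]; exists (a + b); split=> x.
    by rewrite CcD addr_ge0.
  by rewrite CcD => -[/a1 ?|/b1 ?]; [move: (b0 x)|move: (a0 x)]; lra.
- move=> x _; have [p [p01 px _]] := @Cc_bump x setT filterT.
  exists [set y | 1 / 2 < p y]; last first.
    exists (2 *: p); split=> y; rewrite CcZ; first by have := p01 y; lra.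
    by move=> /=; lra.
  by apply: Cc_near_gt; rewrite px; lra.
Qed.

(** The index [d] attached to each function remembers which local datum it is
    subordinate to.  Sums of bumps that are at least 1 on [K] are found by
    [compact_induction], then divided by their maximum with 1. *)
Lemma partition_of_unity (D : choiceType) (U : D -> set X) (K : set X) :
  compact K -> (forall x, K x -> exists d, nbhs x (U d)) ->
  exists s : seq (Cc X R * D),
    [/\ forall pd, pd \in s -> (forall x, 0 <= pd.1 x) /\
          (forall x, pd.1 x != 0 -> U pd.2 x),
        forall x, \sum_(pd <- s) pd.1 x <= 1 &
        forall x, K x -> \sum_(pd <- s) pd.1 x = 1].
Proof.
move=> cK KU; pose P A := exists s : seq (Cc X R * D),
  (forall pd, pd \in s -> (forall x, 0 <= pd.1 x) /\
          (forall x, pd.1 x != 0 -> U pd.2 x)) /\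
  (forall x, A x -> 1 <= \sum_(pd <- s) pd.1 x).
have [s [s0 s1]] : P K.
  apply: (@compact_induction _ P) cK _.
  - by exists [::]; split.
  - by move=> A B AB [c [c0 c1]]; exists c; split=> // x /AB; exact: c1.
  - move=> A B [a [a0 a1]] [b [b0 b1]]; exists (a ++ b); split.
      by move=> pd; rewrite mem_cat => /orP[/a0|/b0].
    have ge (c : seq (Cc X R * D)) x : (forall pd, pd \in c ->
        (forall x, 0 <= pd.1 x) /\ (forall x, pd.1 x != 0 -> U pd.2 x)) ->
        0 <= \sum_(pd <- c) pd.1 x.
      by move=> c0; rewrite big_seq; apply: sumr_ge0 => pd /c0[].
    move=> x; rewrite big_cat /= => -[/a1 ?|/b1 ?].
      by have := ge _ x b0; lra.
    by have := ge _ x a0; lra.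
  - move=> x /KU[d Ud]; have [p [p01 px pU]] := @Cc_bump x _ Ud.
    exists [set y | 1 / 2 < p y]; last first.
      have [q qE] : exists q : Cc X R, forall y, q y = 2 * p y.
        by exists (2 *: p).
      exists [:: (q, d)]; split.
        move=> pd; rewrite inE => /eqP -> /=; split=> y; rewrite qE.
          by have := p01 y; lra.
        by rewrite mulf_eq0 negb_or => /andP[_ /pU].
      by move=> y /=; rewrite big_seq1 /= qE; lra.
    by apply: Cc_near_gt; rewrite px; lra.
pose S : Cc X R := \sum_(pd <- s) pd.1.
have SE x : S x = \sum_(pd <- s) pd.1 x by rewrite Cc_sum.
pose w x := (Num.max (S x) 1)^-1.
have m0 x : 0 < Num.max (S x) 1 by rewrite lt_max ltr01 orbT.
have cw : continuous w.
  move=> x; apply: (@continuousV R X (fun x => Num.max (S x) 1)).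
    by rewrite gt_eqF.
  by apply: continuous_maxr => y; [exact: Cc_continuous|exact: cst_continuous].
have /choice[m mE] : forall phi : Cc X R,
    exists psi : Cc X R, forall x, psi x = w x * phi x.
  by move=> phi; exact: Cc_mul.
exists [seq (m pd.1, pd.2) | pd <- s].
have sumE x : \sum_(pd <- [seq (m pd.1, pd.2) | pd <- s]) pd.1 x = w x * S x.
  by rewrite big_map /= SE big_distrr /=; apply: eq_bigr => pd _; rewrite mE.
split.
- move=> _ /mapP[pd /s0[pd0 pdU] ->] /=; split=> x; rewrite mE.
    by rewrite mulr_ge0 // invr_ge0 ltW.
  by rewrite mulf_eq0 negb_or => /andP[_ /pdU].
- by move=> x; rewrite sumE /w mulrC ler_pdivrMr // mul1r le_max lexx.
- move=> x Kx; rewrite sumE /w; have := s1 x Kx; rewrite -SE => h.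
  by rewrite (max_idPl h) mulVf // gt_eqF //; lra.
Qed.

End Cc_toolkit.
(** * Positive linear forms *)

Local Open Scope ereal_scope.
Local Notation Lint := radon_integral_lsc.

Definition below {X : topologicalType} {R : realType}
    (phi : Cc X R) (g : X -> \bar R) :=
  forall x, (0 <= phi x)%R /\ (phi x)%:E <= g x.

Section radon_linear.
Context {X : topologicalType} {R : realType} (mu : radon X R).
Implicit Types phi psi : Cc X R.
Local Open Scope ring_scope.

Lemma radon_lin a phi psi : mu (a *: phi + psi) = a * mu phi + mu psi.
Proof. exact: radon_scalar. Qed.

Lemma radonD phi psi : mu (phi + psi) = mu phi + mu psi.
Proof. by have := radon_lin 1 phi psi; rewrite scale1r mul1r. Qed.

Lemma radon0 : mu 0 = 0.
Proof. by apply: (@addrI _ (mu 0)); rewrite -radonD !addr0. Qed.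

Lemma radonZ a phi : mu (a *: phi) = a * mu phi.
Proof. by have := radon_lin a phi 0; rewrite addr0 radon0 addr0. Qed.

Lemma radon_sum I (s : seq I) (F : I -> Cc X R) :
  mu (\sum_(i <- s) F i) = \sum_(i <- s) mu (F i).
Proof. by apply: (big_morph _ radonD radon0). Qed.

Lemma radon_le phi psi : (forall x, phi x <= psi x) -> mu phi <= mu psi.
Proof.
move=> h; have := @radon_ge0 _ _ mu (-1 *: phi + psi).
rewrite radon_lin mulN1r [X in _ -> 0 <= X]addrC subr_ge0; apply => x.
by rewrite CcD CcZ mulN1r addrC subr_ge0.
Qed.

Lemma radon_ext phi psi : phi =1 psi -> mu phi = mu psi.
Proof.
by move=> h; apply/eqP; rewrite eq_le !radon_le // => x; rewrite h.
Qed.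

Lemma radon_comb_ex (a b : R) (nu : radon X R) : 0 <= a -> 0 <= b ->
  exists rho : radon X R, forall phi, rho phi = a * mu phi + b * nu phi.
Proof.
move=> a0 b0; pose f phi := a * mu phi + b * nu phi.
have fs : scalar f.
  by move=> c u v; rewrite /f !(radon_scalar _ c u v); ring.
have f0 phi : (forall x, 0 <= phi x) -> 0 <= f phi.
  by move=> h; rewrite addr_ge0 // mulr_ge0 // radon_ge0.
by exists (Radon fs f0).
Qed.

(** The measure of density [theta] with respect to [mu].  The product
    [theta * phi] exists in [Cc X R] only up to a choice, hence the
    quantification over [psi]. *)
Lemma radon_density_ex (theta : Cc X R) : (forall x, 0 <= theta x) ->
  exists rho : radon X R, forall phi psi,
    (forall x, psi x = theta x * phi x) -> rho phi = mu psi.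
Proof.
move=> t0; have /choice[m mE] : forall phi : Cc X R,
    exists psi : Cc X R, forall x, psi x = theta x * phi x.
  by move=> phi; apply: Cc_mul; exact: Cc_continuous.
pose f phi := mu (m phi).
have fs : scalar f.
  move=> c u v; rewrite /f -radon_lin; apply: radon_ext => x.
  by rewrite mE !CcD !CcZ !mE; ring.
have f0 phi : (forall x, 0 <= phi x) -> 0 <= f phi.
  by move=> h; apply: radon_ge0 => x; rewrite mE mulr_ge0.
exists (Radon fs f0) => phi psi h; apply: radon_ext => x.
by rewrite mE h.
Qed.

End radon_linear.

Lemma radon_zero_ex (X : topologicalType) (R : realType) :
  exists rho : radon X R, forall phi, rho phi = 0%R.
Proof.
have fs : scalar (fun _ : Cc X R => 0%R : R).
  by move=> c u v; rewrite mulr0 addr0.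
by exists (Radon fs (fun _ _ => lexx _)).
Qed.

(** * Lower semicontinuous functions *)

Lemma lte_splitD (R : realType) (a : R) (u v : \bar R) : 0 <= u -> 0 <= v ->
  a%:E < u + v -> exists b c : R, [/\ b%:E < u, c%:E < v & (a = b + c)%R].
Proof.
case: u => [u||] //; case: v => [v||] // u0 v0; rewrite ?lte_fin => h.
- exists (u - (u + v - a) / 2)%R, (v - (u + v - a) / 2)%R.
  by rewrite !lte_fin; split; lra.
- exists (u - 1)%R, (a - u + 1)%R; rewrite lte_fin ltry; split=> //; lra.
- exists (a - v + 1)%R, (v - 1)%R; rewrite lte_fin ltry; split=> //; lra.
- by exists a, 0%R; rewrite !ltry addr0.
Qed.

Section lsc.
Context {X : topologicalType} {R : realType}.
Implicit Types (phi psi : Cc X R) (g : X -> \bar R).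

Lemma Glsc_ge0 g x : Glsc g -> 0 <= g x.
Proof. by case=> + _; exact. Qed.

Lemma GlscD g1 g2 : Glsc g1 -> Glsc g2 -> Glsc (fun x => g1 x + g2 x).
Proof.
move=> [p1 l1] [p2 l2]; split; first by move=> x; exact: adde_ge0.
move=> x a /(lte_splitD (p1 x) (p2 x))[b [c [hb hc ->]]].
have [U Ux hU] := l1 _ _ hb; have [V Vx hV] := l2 _ _ hc.
exists (U `&` V); first exact: filterI.
by move=> y [Uy Vy]; rewrite EFinD lteD //; [exact: hU|exact: hV].
Qed.

Lemma GlscZ (c : R) g : (0 < c)%R -> Glsc g -> Glsc (fun x => c%:E * g x).
Proof.
move=> c0 [p l]; split; first by move=> x; rewrite mule_ge0 // lee_fin ltW.
move=> x a; rewrite -lte_pdivrMl // => h.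
have [U Ux hU] := l x (c^-1 * a)%R h.
by exists U => // y /hU; rewrite EFinM lte_pdivrMl.
Qed.

Lemma Glsc_sup (I : Type) (D : set I) (g : I -> X -> \bar R) :
  D !=set0 -> (forall i, D i -> Glsc (g i)) ->
  Glsc (fun x => ereal_sup [set g i x | i in D]).
Proof.
move=> [i0 Di0] Gg; split.
  move=> x; apply: le_ereal_sup_tmp; exists (g i0 x); first by exists i0.
  exact: Glsc_ge0 (Gg _ Di0).
move=> x a /ereal_sup_gt[_ [i Di <-] ha].
have [U Ux hU] := (Gg i Di).2 _ _ ha.
exists U => // y /hU h; apply: (lt_le_trans h).
by apply: ereal_sup_ubound; exists i.
Qed.

Lemma Glsc_max g1 g2 : Glsc g1 -> Glsc g2 ->
  Glsc (fun x => maxe (g1 x) (g2 x)).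
Proof.
move=> [p1 l1] [p2 l2]; split; first by move=> x; rewrite /Fplus le_max p1.
move=> x a; rewrite lt_max => /orP[/l1|/l2] [U Ux hU].
  by exists U => // y /hU h; rewrite lt_max h.
by exists U => // y /hU h; rewrite lt_max h orbT.
Qed.

Lemma Glsc_subpos g phi : Glsc g ->
  Glsc (fun x => maxe (g x - (phi x)%:E) 0).
Proof.
move=> [p l]; split; first by move=> x; rewrite /= le_max lexx orbT.
move=> x a; rewrite lt_max => /orP[h|h]; last first.
  by exists setT; [exact: filterT|move=> y _; rewrite lt_max h orbT].
have := h; rewrite lteBrDr // -EFinD => h'.
have [d [d0 hd]] : exists d : R, (0 < d)%R /\ (a + phi x + d)%:E < g x.
  case: (g x) h' (p x) => [r||] //.
    rewrite lte_fin => h1 _; exists ((r - (a + phi x)) / 2)%R.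
    by rewrite lte_fin; split; lra.
  by exists 1%R; rewrite ltry.
have [U Ux hU] := l _ _ hd.
exists (U `&` [set y | (phi y < phi x + d)%R]).
  by apply: filterI => //; apply: Cc_near_lt; lra.
move=> y [/hU h1 h2]; rewrite lt_max lteBrDr // -EFinD.
by rewrite (lt_trans _ h1) // lte_fin; move: h2 => /=; lra.
Qed.

Lemma Glsc_Cc phi : (forall x, 0 <= phi x)%R -> Glsc (fun x => (phi x)%:E).
Proof.
move=> p0; split; first by move=> x; rewrite /= lee_fin.
move=> x a; rewrite lte_fin => /Cc_near_gt h.
by exists [set y | (a < phi y)%R] => // y; rewrite lte_fin.
Qed.

Lemma Hzero_Cc phi : (forall x, 0 <= phi x)%R -> Hzero (fun x => (phi x)%:E).
Proof.
move=> p0; split.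
- by move=> x; rewrite /= lee_fin.
- by move=> x; rewrite ltry.
- move=> x a; rewrite lte_fin => /Cc_near_lt h.
  by exists [set y | (phi y < a)%R] => // y; rewrite lte_fin.
- exact: Cc_compact.
Qed.

Lemma C0plus_Cc phi : (forall x, 0 <= phi x)%R -> C0plus (fun x => (phi x)%:E).
Proof. by move=> p0; split; [exact: Glsc_Cc|exact: Hzero_Cc]. Qed.

Lemma below_max phi psi g : below phi g -> below psi g ->
  exists chi : Cc X R, below chi g /\
    (forall x, chi x = Num.max (phi x) (psi x)).
Proof.
move=> pg qg; have [chi chiE] := Cc_max phi psi; exists chi; split=> // x.
have [p0 pl] := pg x; have [q0 ql] := qg x.
by rewrite chiE le_max p0; split => //; case: (leP (phi x) (psi x)).
Qed.

Hypothesis hX : hausdorff_space X.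
Hypothesis lX : locally_compact [set: X].

Lemma below_approx g x (a : R) : Glsc g -> a%:E < g x ->
  exists alpha, below alpha g /\ (a <= alpha x)%R.
Proof.
move=> [p l] h; have [a0|a0] := lerP a 0.
  by exists 0%R; split=> // y; split=> //; exact: p.
have [U Ux hU] := l _ _ h; have [q [q01 qx qU]] := @Cc_bump _ R hX lX x U Ux.
exists (a *: q)%R; split=> [y|]; last by rewrite CcZ qx mulr1.
have /andP[q0 q1] := q01 y; rewrite CcZ mulr_ge0 //; last exact: ltW.
split=> //; have [->|/qU/hU h1] := eqVneq (q y) 0%R.
  by rewrite mulr0; exact: p.
by rewrite (le_trans _ (ltW h1)) // lee_fin ler_piMr // ltW.
Qed.

End lsc.

(** * Integration of lower semicontinuous functions *)

Section integral_lsc.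
Context {X : topologicalType} {R : realType}.
Implicit Types (phi psi : Cc X R) (g : X -> \bar R) (mu nu rho : radon X R).

Lemma Lint_ub mu g b : (forall phi, below phi g -> (mu phi)%:E <= b) ->
  Lint mu g <= b.
Proof. by move=> h; apply: ge_ereal_sup => _ [phi pg <-]; exact: h. Qed.

Lemma Lint_ge mu g phi : below phi g -> (mu phi)%:E <= Lint mu g.
Proof. by move=> pg; apply: ereal_sup_ubound; exists phi. Qed.

Lemma Lint_gt mu g (a : \bar R) : a < Lint mu g ->
  exists phi, below phi g /\ a < (mu phi)%:E.
Proof. by case/ereal_sup_gt => _ [phi pg <-] h; exists phi. Qed.

Lemma Lint_ge0 mu g : Fplus g -> 0 <= Lint mu g.
Proof.
move=> g0; have := @Lint_ge mu g 0%R; rewrite radon0; apply => x.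
by split=> //; exact: g0.
Qed.

Lemma Lint_mono mu g1 g2 : fun_le g1 g2 -> Lint mu g1 <= Lint mu g2.
Proof.
move=> h; apply: Lint_ub => phi pg; apply: Lint_ge => x.
by have [p0 pl] := pg x; split=> //; exact: le_trans (h x).
Qed.

Lemma Lint_le_measure mu rho g :
  (forall phi, (forall x, 0 <= phi x)%R -> (rho phi <= mu phi)%R) ->
  Lint rho g <= Lint mu g.
Proof.
move=> h; apply: Lint_ub => phi pg; apply: le_trans (Lint_ge mu pg).
by rewrite lee_fin h // => x; have [] := pg x.
Qed.

Lemma Lint_comb_le (a b : R) mu nu rho g : (0 <= a)%R -> (0 <= b)%R ->
  (forall phi, (rho phi = a * mu phi + b * nu phi)%R) ->
  Lint rho g <= a%:E * Lint mu g + b%:E * Lint nu g.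
Proof.
move=> a0 b0 h; apply: Lint_ub => phi pg; rewrite h EFinD !EFinM.
by apply: leeD; apply: lee_wpmul2l; rewrite ?lee_fin //; exact: Lint_ge.
Qed.

(** Superadditivity in the measure needs one function below [g] that serves
    both measures; the maximum of two does. *)
Lemma Lint_comb_gt (a b a1 b1 : R) mu nu rho g : (0 <= a)%R -> (0 <= b)%R ->
  (forall phi, (rho phi = a * mu phi + b * nu phi)%R) ->
  a1%:E < Lint mu g -> b1%:E < Lint nu g -> (a * a1 + b * b1)%:E <= Lint rho g.
Proof.
move=> a0 b0 h /Lint_gt[phi [pg ha]] /Lint_gt[psi [qg hb]].
have [chi [cg cE]] := below_max pg qg.
apply: le_trans (Lint_ge rho cg); rewrite lee_fin h.
move: ha hb; rewrite !lte_fin => ha hb.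
have h1 : (mu phi <= mu chi)%R by apply: radon_le => x; rewrite cE le_max lexx.
have h2 : (nu psi <= nu chi)%R.
  by apply: radon_le => x; rewrite cE le_max lexx orbT.
apply: lerD; apply: ler_wpM2l => //; apply: ltW.
  exact: lt_le_trans ha h1.
exact: lt_le_trans hb h2.
Qed.

(** The upper integral extends the integral of l.s.c. functions, because the
    infimum that defines it is attained at [g] itself. *)
Lemma radon_integralE mu g : Glsc g -> radon_integral mu g = Lint mu g.
Proof.
move=> Gg; apply/eqP; rewrite eq_le; apply/andP; split.
  by apply: ereal_inf_lbound; exists g => //; split=> // x.
by apply: le_ereal_inf_tmp => _ [h [_ gh] <-]; exact: Lint_mono.
Qed.

Lemma radon_integral_Cc_ge mu phi : (forall x, 0 <= phi x)%R ->
  (mu phi)%:E <= radon_integral mu (fun x => (phi x)%:E).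
Proof.
by move=> p0; rewrite radon_integralE; [apply: Lint_ge => x|exact: Glsc_Cc].
Qed.

Lemma Lint_scale mu (c : R) g : (0 < c)%R ->
  Lint mu (fun x => c%:E * g x) <= c%:E * Lint mu g.
Proof.
move=> c0; apply: Lint_ub => phi pg; rewrite -lee_pdivrMl // -EFinM.
have -> : (c^-1 * mu phi = mu (c^-1 *: phi))%R by rewrite radonZ.
apply: Lint_ge => x; have [p0 pl] := pg x; rewrite CcZ; split.
  by rewrite mulr_ge0 // invr_ge0 ltW.
by rewrite EFinM lee_pdivrMl.
Qed.

Hypothesis hX : hausdorff_space X.
Hypothesis lX : locally_compact [set: X].

(** Continuity of [mu] for uniform convergence on the support of [psi], in the
    one-sided form used for Dini-type arguments: [d] is chosen before [phi]. *)
Lemma radon_le_approx mu psi (e : R) : (0 < e)%R ->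
  exists2 d : R, (0 < d)%R & forall phi, (forall x, 0 <= phi x)%R ->
    (forall x, closed_support psi x -> psi x <= phi x + d)%R ->
    (mu psi <= mu phi + e)%R.
Proof.
move=> e0; have [chi [c0 c1]] := @Cc_ge1 _ R hX lX _ (@Cc_compact _ _ psi).
have mc0 : (0 <= mu chi)%R by exact: radon_ge0.
pose d := (e / (mu chi + 1))%R.
have d0 : (0 < d)%R by rewrite divr_gt0 //; lra.
have dmu : (d * mu chi <= e)%R.
  by rewrite /d mulrAC ler_pdivrMr ?ler_pM2l //; lra.
exists d => // phi phi0 h.
suff : (mu psi <= mu phi + d * mu chi)%R by lra.
rewrite -radonZ -radonD; apply: radon_le => x; rewrite CcD CcZ.
have [->|/Cc_support px] := eqVneq (psi x) 0%R.
  by rewrite addr_ge0 // mulr_ge0 // ltW.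
have := h x px; have : (d <= d * chi x)%R by rewrite ler_peMr ?c1 // ltW.
by lra.
Qed.

(** A [psi <= g1 + g2] is nearly below a sum [a1 + a2] with [ai <= gi]: this
    holds near each point of its compact support, and maxima glue the local
    solutions. *)
Lemma Lint_add mu g1 g2 : Glsc g1 -> Glsc g2 ->
  Lint mu (fun x => g1 x + g2 x) <= Lint mu g1 + Lint mu g2.
Proof.
move=> G1 G2; apply: Lint_ub => psi pg.
apply/lee_addgt0Pr => e e0.
have [d d0 hd] := radon_le_approx mu psi e0.
pose P A := exists a1 a2, [/\ below a1 g1, below a2 g2 &
  forall x, A x -> (psi x - d <= a1 x + a2 x)%R].
have [a1 [a2 [b1 b2 h]]] : P (closed_support psi).
  apply: (@compact_induction _ P) (@Cc_compact _ _ psi) _.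
  - by exists 0%R, 0%R; split=> // x; split=> //; exact: Glsc_ge0.
  - by move=> A B AB [a1 [a2 [b1 b2 h]]]; exists a1, a2; split=> // x /AB /h.
  - move=> A B [a1 [a2 [b1 b2 h]]] [a1' [a2' [b1' b2' h']]].
    have [m1 [c1' m1E]] := below_max b1 b1'.
    have [m2 [c2' m2E]] := below_max b2 b2'.
    exists m1, m2; split=> // x; rewrite m1E m2E => -[/h|/h'] hx;
      apply: (le_trans hx); apply: lerD; rewrite le_max lexx ?orbT //.
  - move=> x _; have [p0 pl] := pg x.
    have hx : (psi x - d / 2)%:E < g1 x + g2 x.
      by rewrite (lt_le_trans _ pl) // lte_fin; lra.
    have [r1 [r2 [hr1 hr2 rE]]] := lte_splitD (Glsc_ge0 x G1) (Glsc_ge0 x G2) hx.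
    have [a1 [b1 h1]] := below_approx hX lX G1 hr1.
    have [a2 [b2 h2]] := below_approx hX lX G2 hr2.
    have [t tE] : exists t : Cc X R, forall y, (t y = a1 y + a2 y - psi y)%R.
      by exists (a1 + a2 - psi)%R.
    exists [set y | (- d < t y)%R].
      by apply: Cc_near_gt; rewrite tE; lra.
    by exists a1, a2; split=> // y /=; rewrite tE; lra.
have le : (mu psi <= mu a1 + mu a2 + e)%R.
  rewrite -radonD; apply: hd => x; rewrite CcD.
    by have [[? _] [? _]] := (b1 x, b2 x); exact: addr_ge0.
  by move=> /h; lra.
apply: (@le_trans _ _ ((mu a1)%:E + (mu a2)%:E + e%:E)).
  by rewrite -!EFinD lee_fin; lra.
by rewrite leeD2r // leeD //; exact: Lint_ge.
Qed.

(** Monotone convergence, by Dini's argument on the support of a test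
    function. *)
Lemma Lint_sup_nat mu (S : nat -> X -> \bar R) b :
  (forall n, Glsc (S n)) -> (forall n m, (n <= m)%N -> fun_le (S n) (S m)) ->
  (forall n, Lint mu (S n) <= b) ->
  Lint mu (fun x => ereal_sup [set S n x | n in setT]) <= b.
Proof.
move=> GS incr SB; apply: Lint_ub => psi pg.
apply/lee_addgt0Pr => e e0.
have [d d0 hd] := radon_le_approx mu psi e0.
pose P A := exists n, forall x, A x -> (psi x - d)%:E <= S n x.
have [n h] : P (closed_support psi).
  apply: (@compact_induction _ P) (@Cc_compact _ _ psi) _.
  - by exists 0%N.
  - by move=> A B AB [n h]; exists n => x /AB /h.
  - move=> A B [n h] [m h']; exists (maxn n m) => x [/h|/h'] hx;
      apply: (le_trans hx); apply: incr; rewrite leq_max leqnn ?orbT //.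
  - move=> x _; have [p0 pl] := pg x.
    have : (psi x - d / 2)%:E < ereal_sup [set S n x | n in setT].
      by rewrite (lt_le_trans _ pl) // lte_fin; lra.
    move=> /ereal_sup_gt[_ [n _ <-] hn].
    have [U Ux hU] := (GS n).2 _ _ hn.
    exists (U `&` [set y | (psi y < psi x + d / 2)%R]).
      by apply: filterI => //; apply: Cc_near_lt; lra.
    exists n => y [/hU h1 /= h2]; apply: ltW; apply: lt_trans h1.
    by rewrite lte_fin; lra.
have [a aE] := @Cc_subpos _ _ psi d (ltW d0).
have ab : below a (S n).
  move=> x; rewrite aE le_max lexx orbT; split=> //.
  have s0 := Glsc_ge0 x (GS n).
  have [p0|pn0] := eqVneq (psi x) 0%R.
    rewrite p0 sub0r; have -> : Num.max (- d)%R 0%R = 0%R :> R; last by [].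
    by apply/max_idPr; lra.
  by have := h x (Cc_support pn0); case: (leP (psi x - d)%R 0%R).
have le : (mu psi <= mu a + e)%R.
  apply: hd => x; rewrite aE; first by rewrite le_max lexx orbT.
  by rewrite -lerBlDr le_max lexx.
apply: (@le_trans _ _ ((mu a)%:E + e%:E)).
  by rewrite -!EFinD lee_fin; lra.
by rewrite leeD2r //; exact: le_trans (Lint_ge mu ab) (SB n).
Qed.

End integral_lsc.
(** * Potentials and mutual energy *)

(** Finite sums of products, which play the part of continuous functions on
    [X * X] whose two iterated integrals visibly agree. *)
Definition tensor_below {X : topologicalType} {R : realType}
    (t : seq (Cc X R * Cc X R)) (G : X * X -> \bar R) :=
  forall x y, (0 <= \sum_(p <- t) p.1 x * p.2 y)%R /\
    (\sum_(p <- t) p.1 x * p.2 y)%:E <= G (x, y).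

Section kernel.
Context {X : topologicalType} {R : realType}.
Variable G : X * X -> \bar R.
Hypothesis hX : hausdorff_space X.
Hypothesis lX : locally_compact [set: X].
Hypothesis Gk : is_kernel G.
Implicit Types (phi psi : Cc X R) (mu nu : radon X R).

Lemma kernel_slice x : Glsc (fun y => G (x, y)).
Proof.
case: Gk => G0 Gl _ _; split; first by move=> y; exact: G0.
move=> y a /Gl[W [[A B] /= [Ax By] AB] hW].
exists B => // z Bz; apply: hW; apply: AB; split=> //.
exact: nbhs_singleton.
Qed.

(** Up to a loss of [d], a continuous minorant of compact support of the slice
    at [x0] remains a minorant of the nearby slices: the tube lemma for the open
    set where [G (x, y)] exceeds [phi y - d]. *)
Lemma kernel_slice_stable x0 phi (d : R) : (0 < d)%R ->
  below phi (fun y => G (x0, y)) ->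
  exists2 U, nbhs x0 U & forall x, U x -> forall y,
    (Num.max (phi y - d) 0)%:E <= G (x, y).
Proof.
move=> d0 pg; case: Gk => G0 Gl _ _.
pose P (S : set X) := exists2 U, nbhs x0 U &
  forall x, U x -> forall y, S y -> (phi y - d)%:E <= G (x, y).
have [U Ux hU] : P (closed_support phi).
  apply: (@compact_induction _ P) (@Cc_compact _ _ phi) _.
  - by exists setT; first exact: filterT.
  - by move=> A B AB [U Ux hU]; exists U => // x /hU h y /AB; exact: h.
  - move=> A B [U Ux hU] [V Vx hV]; exists (U `&` V); first exact: filterI.
    by move=> x [/hU h1 /hV h2] y [/h1|/h2].
  - move=> y0 _; have [p0 pl] := pg y0.
    have : (phi y0 - d / 2)%:E < G (x0, y0).
      by rewrite (lt_le_trans _ pl) // lte_fin; lra.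
    move=> /Gl[W [[A B] /= [Ax By] AB] hW].
    exists (B `&` [set y | (phi y < phi y0 + d / 2)%R]).
      by apply: filterI => //; apply: Cc_near_lt; lra.
    exists A => // x Axx y [Byy /= hy]; apply: ltW.
    apply: lt_trans (hW (x, y) (AB (x, y) (conj Axx Byy))).
    by rewrite lte_fin; lra.
exists U => // x /hU h y.
have [p0|pn0] := eqVneq (phi y) 0%R.
  rewrite p0 sub0r; have -> : Num.max (- d)%R 0%R = 0%R :> R; last exact: G0.
  by apply/max_idPr; lra.
have := h y (Cc_support pn0).
by case: (leP (phi y - d)%R 0%R) => // _ _; exact: G0.
Qed.

Lemma kernel_slice_approx nu x0 (a : R) : a%:E < Lint nu (fun y => G (x0, y)) ->
  exists v : Cc X R, [/\ (forall y, 0 <= v y)%R, (a < nu v)%R &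
    exists2 U, nbhs x0 U & forall x, U x -> forall y, (v y)%:E <= G (x, y)].
Proof.
move=> /Lint_gt[v0 [vg]]; rewrite lte_fin => ha.
have a2 : (0 < (nu v0 - a) / 2)%R by lra.
have [d d0 hd] := radon_le_approx hX lX nu v0 a2.
have [v vE] := @Cc_subpos _ _ v0 d (ltW d0).
exists v; split.
- by move=> y; rewrite vE le_max lexx orbT.
- suff : (nu v0 <= nu v + (nu v0 - a) / 2)%R by lra.
  apply: hd => y; rewrite vE; first by rewrite le_max lexx orbT.
  by rewrite -lerBlDr le_max lexx.
- have [U Ux hU] := kernel_slice_stable d0 vg.
  by exists U => // x /hU h y; rewrite vE.
Qed.

Lemma potentialE nu x : potential G nu x = Lint nu (fun y => G (x, y)).
Proof. by rewrite /potential radon_integralE //; exact: kernel_slice. Qed.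

Lemma Glsc_potential nu : Glsc (potential G nu).
Proof.
split.
  by move=> x; rewrite potentialE; apply: Lint_ge0; exact: (kernel_slice x).1.
move=> x a; rewrite potentialE => /kernel_slice_approx[v [v0 av [U Ux hU]]].
exists U => // y /hU h; rewrite potentialE.
apply: (@lt_le_trans _ _ (nu v)%:E); first by rewrite lte_fin.
by apply: Lint_ge => z.
Qed.

Lemma tensor_le mu nu t : tensor_below t G ->
  (\sum_(p <- t) mu p.1 * nu p.2)%:E <= Lint mu (potential G nu).
Proof.
move=> tG; pose phi : Cc X R := (\sum_(p <- t) nu p.2 *: p.1)%R.
have phiE x : phi x = nu (\sum_(p <- t) p.1 x *: p.2)%R.
  rewrite Cc_sum radon_sum; apply: eq_bigr => p _.
  by rewrite CcZ radonZ mulrC.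
have sE x y : ((\sum_(p <- t) p.1 x *: p.2) y = \sum_(p <- t) p.1 x * p.2 y)%R.
  by rewrite Cc_sum.
have -> : (\sum_(p <- t) mu p.1 * nu p.2 = mu phi)%R.
  by rewrite radon_sum; apply: eq_bigr => p _; rewrite radonZ mulrC.
apply: Lint_ge => x; rewrite phiE potentialE; split.
  by apply: radon_ge0 => y; rewrite sE; have [] := tG x y.
by apply: Lint_ge => y; rewrite sE; exact: tG.
Qed.

(** A test function [phi] below the potential is approximated by patching, with
    a partition of unity in [x], test functions in [y] which minorize all slices
    near a given point and nearly realize [phi] there. *)
Lemma tensor_approx mu nu (a : R) : a%:E < Lint mu (potential G nu) ->
  exists t, tensor_below t G /\ (a < \sum_(p <- t) mu p.1 * nu p.2)%R.
Proof.
move=> /Lint_gt[phi [pg]]; rewrite lte_fin => ha.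
have G0 : forall z, 0 <= G z by case: Gk.
have a2 : (0 < (mu phi - a) / 2)%R by lra.
have [d d0 hd] := radon_le_approx hX lX mu phi a2.
pose U (v : Cc X R) : set X := [set x | [/\ (forall y, 0 <= v y)%R,
  (phi x - d <= nu v)%R & forall y, (v y)%:E <= G (x, y)]].
have [|s [sU s1 sK]] := @partition_of_unity X R hX lX (Cc X R) U _ (@Cc_compact _ _ phi).
  move=> x _.
  have [p0 pl] := pg x.
  have : (phi x - d / 2)%:E < Lint nu (fun y => G (x, y)).
    by rewrite -potentialE (lt_le_trans _ pl) // lte_fin; lra.
  move=> /kernel_slice_approx[v [v0 av [V Vx hV]]]; exists v.
  have hn : nbhs x [set y | (phi y < phi x + d / 2)%R].
    by apply: Cc_near_lt; lra.
  apply: filterS (filterI Vx hn) => y [Vy /= hy].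
  by split=> //; [lra|exact: hV].
exists s; split.
  move=> x y; rewrite !big_seq; split.
    apply: sumr_ge0 => p ps; have [p0 pU] := sU _ ps.
    have [->|/pU[v0 _ _]] := eqVneq (p.1 x) 0%R; first by rewrite mul0r.
    by rewrite mulr_ge0.
  have := G0 (x, y); case GE : (G (x, y)) => [r||] //; last first.
    by move=> _; exact: leey.
  rewrite !lee_fin => r0.
  apply: (@le_trans _ _ (\sum_(p <- s | p \in s) p.1 x * r)%R).
    apply: ler_sum => p ps; have [p0 pU] := sU _ ps.
    have [->|/pU[v0 _ vG]] := eqVneq (p.1 x) 0%R; first by rewrite !mul0r.
    by rewrite ler_wpM2l // -lee_fin -GE.
  by rewrite -big_seq -big_distrl /= ler_piMl.
pose psi : Cc X R := (\sum_(p <- s) nu p.2 *: p.1)%R.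
suff : (a < mu psi)%R.
  move=> /lt_le_trans; apply; rewrite radon_sum le_eqVlt; apply/orP; left.
  by apply/eqP; apply: eq_bigr => p _; rewrite radonZ mulrC.
have psiE x : (psi x = \sum_(p <- s) p.1 x * nu p.2)%R.
  by rewrite Cc_sum; apply: eq_bigr => p _; rewrite CcZ mulrC.
suff : (mu phi <= mu psi + (mu phi - a) / 2)%R by lra.
apply: hd => x => [|px]; rewrite psiE.
  rewrite big_seq; apply: sumr_ge0 => p ps; have [q0 pU] := sU _ ps.
  have [->|/pU[v0 _ _]] := eqVneq (p.1 x) 0%R; first by rewrite mul0r.
  by rewrite mulr_ge0 // radon_ge0.
rewrite -lerBlDr -[leLHS]mul1r -(sK x px) big_distrl /= big_seq [leRHS]big_seq.
apply: ler_sum => p ps; have [q0 pU] := sU _ ps.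
have [->|/pU[_ h _]] := eqVneq (p.1 x) 0%R; first by rewrite !mul0r.
by rewrite ler_wpM2l.
Qed.

(** Exchanging the factors turns a tensor below [G] into another one, and both
    iterated integrals are suprema over such tensors. *)
Lemma mutual_energy_sym mu nu : Lint mu (potential G nu) = Lint nu (potential G mu).
Proof.
suff le m n : Lint m (potential G n) <= Lint n (potential G m).
  by apply/eqP; rewrite eq_le !le.
rewrite leNgt; apply/negP => h.
have n0 : 0 <= Lint n (potential G m).
  by apply: Lint_ge0; exact: (Glsc_potential m).1.
have [r rE] : exists r : R, Lint n (potential G m) = r%:E.
  move: n0 h; case: (Lint n _) => [r||] //; first by exists r.
  by move=> _; rewrite ltNge leey.
move: h; rewrite rE => /tensor_approx[t [tG]].
rewrite ltNge => /negP; apply; rewrite -lee_fin -rE.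
pose t' := [seq (p.2, p.1) | p <- t].
have t'G : tensor_below t' G.
  case: Gk => _ _ Gs _ x y; rewrite Gs /t' big_map /=.
  by under eq_bigr do rewrite mulrC; exact: tG.
have := @tensor_le n m t' t'G; rewrite /t' big_map /=.
by under eq_bigr do rewrite mulrC.
Qed.

Lemma energy_normE mu : energy_norm G mu = sqrte (Lint mu (potential G mu)).
Proof. by rewrite /energy_norm radon_integralE //; exact: Glsc_potential. Qed.

Lemma energy_ge0 mu nu : 0 <= Lint mu (potential G nu).
Proof. by apply: Lint_ge0; exact: (Glsc_potential nu).1. Qed.

Lemma Eplus1E mu : Eplus1 G mu <-> Lint mu (potential G mu) <= 1.
Proof.
rewrite /Eplus1 /= energy_normE; have := energy_ge0 mu mu.
case: (Lint mu _) => [r||] //=; rewrite !lee_fin => r0.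
by rewrite -[in X in X <-> _]sqrtr1 ler_sqrt.
Qed.

Lemma Eplus1_Eplus mu : Eplus1 G mu -> Eplus G mu.
Proof. by rewrite /Eplus1 /Eplus /= => /le_lt_trans; apply; rewrite ltry. Qed.

End kernel.
(** * Vague compactness of the energy ball *)

Lemma initial_cvg (S : choiceType) (T : topologicalType) (f : S -> T)
    (F : set_system S) (s : S) : Filter F ->
  f @ F --> f s -> F --> (s : initial_topology f).
Proof.
move=> FF h A /= [_ [[B Bop <-] Bs sBA]]; apply: filterS sBA _.
by apply: h; exact: open_nbhs_nbhs.
Qed.

Lemma vague_cvg (X : topologicalType) (R : realType)
    (F : set_system (radon X R)) (mu : radon X R) : Filter F ->
  (forall phi, (fun m : radon X R => m phi) @ F --> mu phi) -> F --> mu.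
Proof.
move=> FF h; apply: initial_cvg.
by apply/cvg_sup => phi; apply: initial_cvg; exact: h.
Qed.

Lemma vague_continuous (X : topologicalType) (R : realType) (phi : Cc X R) :
  continuous (fun m : radon X R => m phi).
Proof.
move=> mu; pose f (m : radon X R) : {ptws Cc X R -> R} := m.
have cf : {for mu, continuous f}.
  exact: (@initial_continuous _ _
    (fun mu : radon X R => (mu : {ptws Cc X R -> R})) mu).
exact: (continuous_comp cf (@proj_continuous _ _ phi (f mu))).
Qed.

Lemma cvg_eventually_gt (T : Type) (R : realType) (F : set_system T)
    (f : T -> R) (l a : R) : f @ F --> l -> (a < l)%R -> F [set t | (a < f t)%R].
Proof.
move=> fl al; have /(_ [set z | (a < z)%R]) := fl; apply.
by apply: open_nbhs_nbhs; split; first exact: open_gt.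
Qed.

Lemma ultra_cvg_segment (T : Type) (R : realType) (U : set_system T)
    (f : T -> R) (B : R) : UltraFilter U ->
  U [set t | `|f t| <= B]%R -> exists l : R, f @ U --> l.
Proof.
move=> UU UB.
have PF : ProperFilter (f @ U) by exact: fmap_proper_filter.
have [|l [_ cl]] := @segment_compact R (- B)%R B (f @ U) PF.
  apply: filterS UB => t h; rewrite /= in_itv /= -ler_norml. exact: h.
exists l => V Vl.
have [//|h] := in_ultra_setVsetC (f @^-1` V) UU.
have [y [ny Vy]] : (~` V `&` V) !=set0 by apply: cl.
by [].
Qed.

Section compactness.
Context {X : topologicalType} {R : realType}.
Variable G : X * X -> \bar R.
Hypothesis hX : hausdorff_space X.
Hypothesis lX : locally_compact [set: X].
Hypothesis Gk : is_kernel G.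
Implicit Types (phi psi : Cc X R) (mu nu : radon X R).

(** Where [G > c > 0] on [U * U], a bump [p] supported in [U] satisfies
    [c * (mu p)^2 <= 1], as [c * p(x) * p(y)] is a tensor below [G]. *)
Lemma Eplus1_bump_bounded (x : X) : exists2 U, nbhs x U &
  forall p : Cc X R, (forall y, 0 <= p y <= 1)%R ->
    (forall y, p y != 0%R -> U y) ->
  exists B : R, forall mu, Eplus1 G mu -> (mu p <= B)%R.
Proof.
case: (Gk) => G0 Gl _ /(_ x) Gx.
have [c [c0 hc]] : exists c : R, (0 < c)%R /\ c%:E < G (x, x).
  case: (G (x, x)) Gx => [r||] //; last by exists 1%R; rewrite ltry.
  by rewrite lte_fin => r0; exists (r / 2)%R; rewrite lte_fin; split; lra.
have [W [[A B] /= [Ax Bx] AB] hW] := Gl _ _ hc.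
exists (A `&` B); first exact: filterI.
move=> p p01 pU; exists (1 + c^-1)%R => mu /(Eplus1E hX lX Gk).
have [cp cpE] : exists q : Cc X R, q = (c *: p)%R by exists (c *: p)%R.
have tG : tensor_below [:: (cp, p)] G.
  move=> y z; rewrite big_seq1 /= cpE CcZ.
  have /andP[py0 py1] := p01 y; have /andP[pz0 pz1] := p01 z.
  split; first by rewrite !mulr_ge0 // ltW.
  have [->|/pU[Ay _]] := eqVneq (p y) 0%R; first by rewrite mulr0 mul0r.
  have [->|/pU[_ Bz]] := eqVneq (p z) 0%R; first by rewrite mulr0.
  apply: le_trans (ltW (hW (y, z) (AB (y, z) (conj Ay Bz)))).
  rewrite lee_fin -mulrA ler_piMr //; first exact: ltW.
  by rewrite mulr_ile1.
move/(le_trans (tensor_le Gk mu mu tG)).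
rewrite big_seq1 /= cpE radonZ lee_fin => h.
have m0 : (0 <= mu p)%R by apply: radon_ge0 => y; have /andP[] := p01 y.
rewrite leNgt; apply/negP => lt.
have ci : (c * c^-1 = 1)%R by rewrite mulfV // gt_eqF.
have ci0 : (0 < c^-1)%R by rewrite invr_gt0.
have : (1 < c * mu p)%R by rewrite -ci ltr_pM2l //; lra.
by nra.
Qed.

Lemma Eplus1_bounded phi :
  exists B : R, forall mu, Eplus1 G mu -> (`|mu phi| <= B)%R.
Proof.
pose P A := exists psi, [/\ (forall x, 0 <= psi x)%R,
  (forall x, A x -> `|phi x| <= psi x)%R &
  exists B : R, forall mu, Eplus1 G mu -> (mu psi <= B)%R].
have [psi [psi0 hpsi [B hB]]] : P (closed_support phi).
  apply: (@compact_induction _ P) (@Cc_compact _ _ phi) _.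
  - exists 0%R; split=> //; exists 0%R => mu _.
    by rewrite radon0.
  - by move=> A B AB [psi [h0 h1 h2]]; exists psi; split=> // x /AB /h1.
  - move=> A B [a [a0 ha [Ba hBa]]] [b [b0 hb [Bb hBb]]].
    exists (a + b)%R; split=> [x|x|].
    + by rewrite CcD addr_ge0.
    + rewrite CcD => -[/ha|/hb] h.
        by rewrite (le_trans h) // lerDl.
      by rewrite (le_trans h) // lerDr.
    + exists (Ba + Bb)%R => mu E; rewrite radonD; apply: lerD.
        exact: hBa.
      exact: hBb.
  - move=> x _; have [U Ux hU] := Eplus1_bump_bounded x.
    have [p [p01 px pU]] := @Cc_bump _ R hX lX x U Ux.
    have [B hB] := hU p p01 pU.
    pose c := (`|phi x| + 1)%R.
    have c0 : (0 < c)%R by rewrite /c; have := normr_ge0 (phi x); lra.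
    have [q qE] : exists q : Cc X R, q = (2 * c *: p)%R by exists (2 * c *: p)%R.
    have qxE y : (q y = 2 * c * p y)%R by rewrite qE CcZ.
    exists ([set y | (1 / 2 < p y)%R] `&`
        ([set y | (phi y < c)%R] `&` [set y | (- c < phi y)%R])).
      apply: filterI; first by apply: Cc_near_gt; rewrite px; lra.
      have := ler_norm (phi x); have := ler_norm (- phi x)%R; rewrite normrN.
      rewrite /c => h1 h2.
      by apply: filterI; [apply: Cc_near_lt|apply: Cc_near_gt]; lra.
    exists q; split=> [y|y [/= h1 [/= h2 h3]]|].
    + by have /andP[py0 _] := p01 y; rewrite qxE !mulr_ge0 // ltW.
    + by rewrite qxE ler_norml; apply/andP; split; nra.
    + exists (2 * c * B)%R => mu E; rewrite qE radonZ ler_wpM2l ?hB //.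
      by rewrite mulr_ge0 // ltW.
have hphi x : (`|phi x| <= psi x)%R.
  have [->|/Cc_support/hpsi //] := eqVneq (phi x) 0%R.
  by rewrite normr0.
exists B => mu E; apply: le_trans (hB mu E); rewrite ler_norml.
apply/andP; split.
  rewrite -mulN1r -radonZ; apply: radon_le => x; rewrite CcZ mulN1r.
  by have := hphi x; rewrite ler_norml => /andP[].
by apply: radon_le => x; rewrite (le_trans (ler_norm _)).
Qed.

(** Along an ultrafilter of measures of the ball each [m phi] stays bounded, so
    it converges; the limits form a positive linear form.  Its energy is at most
    1 because a tensor below [G] whose integral exceeded 1 would also do so for
    some measure of the ball. *)
Lemma Eplus1_compact : compact (Eplus1 G : set (radon X R)).
Proof.
rewrite compact_ultra => U UU UE.
have /choice[l lE] : forall phi : Cc X R, exists l : R,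
    (fun m : radon X R => m phi) @ U --> l.
  move=> phi; have [B hB] := Eplus1_bounded phi.
  by apply: (@ultra_cvg_segment _ _ _ _ B) => //; apply: filterS UE => mu /hB.
have uniq (f : radon X R -> R) (a b : R) : f @ U --> a -> f @ U --> b -> a = b.
  have PF : ProperFilter (f @ U) by exact: fmap_proper_filter.
  exact: (@cvg_unique R (@Rhausdorff R) (f @ U) PF a b).
have ls : scalar l.
  move=> c u v; apply: (uniq _ _ _ (lE _)).
  rewrite (_ : (fun m : radon X R => m (c *: u + v)%R) =
    (fun m => c * m u + m v)%R); last first.
    by apply/funext => m; rewrite radon_lin.
  by apply: cvgD (lE v); apply: cvgMr; exact: lE.
have l0 phi : (forall x, 0 <= phi x)%R -> (0 <= l phi)%R.
  move=> p0; rewrite leNgt; apply/negP => h.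
  have lN : (fun m : radon X R => - m phi)%R @ U --> (- l phi)%R.
    by apply: cvgN; exact: lE.
  have [|m /=] := filter_ex (@cvg_eventually_gt _ _ _ _ _ 0%R lN _).
    by rewrite oppr_gt0.
  by rewrite oppr_gt0 ltNge radon_ge0.
pose mu := Radon ls l0; exists mu; split; last first.
  by apply: vague_cvg => phi; exact: lE.
apply/(Eplus1E hX lX Gk); rewrite leNgt; apply/negP => h.
have [t [tG ht]] := tensor_approx hX lX Gk h.
have tcvg (s : seq (Cc X R * Cc X R)) :
    (fun m : radon X R => \sum_(p <- s) m p.1 * m p.2)%R @ U -->
    (\sum_(p <- s) l p.1 * l p.2)%R.
  elim: s => [|p s IH].
    rewrite big_nil; apply: cvg_trans (@cvg_cst _ (0%R : R) _ U _).
    by apply: near_eq_cvg; apply: nearW => m; rewrite big_nil.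
  rewrite big_cons; under eq_fun do rewrite big_cons.
  by apply: cvgD => //; apply: cvgM; exact: lE.
have [m [hm Em]] := filter_ex (filterI (cvg_eventually_gt (tcvg t) ht) UE).
move: hm => /=; rewrite ltNge => /negP; apply; rewrite -lee_fin.
exact: le_trans (tensor_le Gk m m tG) ((Eplus1E hX lX Gk m).1 Em).
Qed.

End compactness.
(** * The outer capacity *)

Lemma ereal_inf0P (R : realType) (S : set (\bar R)) :
  (forall s, S s -> 0 <= s) ->
  ereal_inf S = 0 <-> forall e : R, (0 < e)%R -> exists2 s, S s & s < e%:E.
Proof.
move=> S0; split=> [S0E e e0|h].
  by apply/ereal_inf_ltP; rewrite S0E lte_fin.
apply/eqP; rewrite eq_le; apply/andP; split; last exact: le_ereal_inf_tmp.
apply/lee_addgt0Pr => e e0; rewrite add0e.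
have [s Ss se] := h e e0.
by apply: le_trans (ltW se); exact: ereal_inf_lbound.
Qed.

Section capacity.
Context {X : topologicalType} {R : realType}.
Variable G : X * X -> \bar R.
Hypothesis hX : hausdorff_space X.
Hypothesis lX : locally_compact [set: X].
Hypothesis Gk : is_kernel G.
Implicit Types (phi psi : Cc X R) (mu nu : radon X R) (f g : X -> \bar R).

Lemma outer_cap_le f g (a : \bar R) : Glsc g -> fun_le f g ->
  (forall mu, Eplus1 G mu -> Lint mu g <= a) -> outer_cap G f <= a.
Proof.
move=> Gg fg h; apply: (@le_trans _ _ (cap_lsc G g)).
  by apply: ereal_inf_lbound; exists g.
apply: ge_ereal_sup => _ [phi [[Gphi _] pg] <-].
apply: ge_ereal_sup => _ [mu Emu <-]; rewrite radon_integralE //.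
by apply: le_trans (h mu Emu); exact: Lint_mono.
Qed.

Lemma Lint_cap mu g : Eplus1 G mu -> Lint mu g <= cap_lsc G g.
Proof.
move=> Emu; apply: Lint_ub => phi pg.
have p0 x : (0 <= phi x)%R by have [] := pg x.
apply: le_trans (radon_integral_Cc_ge mu p0) _.
apply: (@le_trans _ _ (cap_C0 G (fun x => (phi x)%:E))).
  by apply: ereal_sup_ubound; exists mu.
apply: ereal_sup_ubound; exists (fun x => (phi x)%:E) => //; split.
  exact: C0plus_Cc.
by move=> x; have [] := pg x.
Qed.

Lemma outer_cap_lt f (a : \bar R) : outer_cap G f < a ->
  exists g b, [/\ Glsc g, fun_le f g, b < a &
    forall mu, Eplus1 G mu -> Lint mu g <= b].
Proof.
move=> /ereal_inf_ltP[_ [g [Gg fg] <-] h].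
by exists g, (cap_lsc G g); split=> // mu; exact: Lint_cap.
Qed.

Lemma Eplus1_zero : exists zeta : radon X R,
  Eplus1 G zeta /\ forall phi, zeta phi = 0%R.
Proof.
have [zeta z0] := radon_zero_ex X R; exists zeta; split=> //.
by apply/(Eplus1E hX lX Gk); apply: Lint_ub => phi _; rewrite z0.
Qed.

Lemma outer_cap_ge0 f : 0 <= outer_cap G f.
Proof.
apply: le_ereal_inf_tmp => _ [g [Gg _] <-].
have [zeta [Ez _]] := Eplus1_zero.
by apply: le_trans (Lint_cap g Ez); apply: Lint_ge0; case: Gg.
Qed.

Lemma outer_cap_add f f1 f2 (a b : R) : (forall x, f x <= f1 x + f2 x) ->
  outer_cap G f1 < a%:E -> outer_cap G f2 < b%:E ->
  outer_cap G f < (a + b)%:E.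
Proof.
move=> h /outer_cap_lt[g1 [a' [G1 l1 a1 h1]]] /outer_cap_lt[g2 [b' [G2 l2 b1 h2]]].
rewrite EFinD; apply: le_lt_trans (lteD a1 b1).
apply: (outer_cap_le (GlscD G1 G2)) => [x|mu E].
  by apply: (le_trans (h x)); apply: leeD.
apply: (le_trans (Lint_add hX lX mu G1 G2)).
by apply: leeD; [exact: h1|exact: h2].
Qed.

Lemma outer_cap_scale f f1 (c a : R) : (0 < c)%R ->
  (forall x, f x <= c%:E * f1 x) ->
  outer_cap G f1 < a%:E -> outer_cap G f < (c * a)%:E.
Proof.
move=> c0 h /outer_cap_lt[g1 [a' [G1 l1 a1 h1]]].
apply: (@le_lt_trans _ _ (c%:E * a')); last by rewrite EFinM lte_pmul2l.
apply: (outer_cap_le (GlscZ c0 G1)) => [x|mu E].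
  by apply: (le_trans (h x)); rewrite lee_pmul2l.
apply: (le_trans (Lint_scale mu g1 c0)).
by rewrite lee_pmul2l // h1.
Qed.

Lemma Hzero_starP f : Fplus f -> Hzero_star G f <->
  forall e : R, (0 < e)%R -> exists h, [/\ Hzero h, fun_le h f &
    outer_cap G (fun x => f x - h x) < e%:E].
Proof.
move=> f0; rewrite /Hzero_star /=.
have S0 s : [set outer_cap G (fun x => f x - h x) |
    h in [set h | Hzero h /\ fun_le h f]] s -> 0 <= s.
  by case=> h _ <-; exact: outer_cap_ge0.
split=> [[_ /(ereal_inf0P S0) h] e /h [_ [k [k1 k2] <-] kl]|h].
  by exists k.
split=> //; apply/(ereal_inf0P S0) => e /h [k [k1 k2 k3]].
by exists (outer_cap G (fun x => f x - k x)) => //; exists k.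
Qed.

Lemma quasicompactP (A : set X) : quasicompact G A <->
  forall e : R, (0 < e)%R -> exists K, [/\ compact K, K `<=` A &
    outer_cap_set G (A `\` K) < e%:E].
Proof.
have S0 s : [set outer_cap_set G (A `\` K) |
    K in [set K | compact K /\ K `<=` A]] s -> 0 <= s.
  by case=> h _ <-; exact: outer_cap_ge0.
split=> [/(ereal_inf0P S0) h e /h [_ [k [k1 k2] <-] kl]|h].
  by exists k.
apply/(ereal_inf0P S0) => e /h [k [k1 k2 k3]].
by exists (outer_cap_set G (A `\` k)) => //; exists k.
Qed.

Lemma quasiclosedP (A : set X) : quasiclosed G A <->
  forall e : R, (0 < e)%R -> exists K, [/\ closed K, K `<=` A &
    outer_cap_set G (A `\` K) < e%:E].
Proof.
have S0 s : [set outer_cap_set G (A `\` K) |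
    K in [set K | closed K /\ K `<=` A]] s -> 0 <= s.
  by case=> h _ <-; exact: outer_cap_ge0.
split=> [/(ereal_inf0P S0) h e /h [_ [k [k1 k2] <-] kl]|h].
  by exists k.
apply/(ereal_inf0P S0) => e /h [k [k1 k2 k3]].
by exists (outer_cap_set G (A `\` k)) => //; exists k.
Qed.

End capacity.

(** * Consequences of consistency *)

Section domination.
Context {X : topologicalType} {R : realType}.
Variable G : X * X -> \bar R.
Hypothesis hX : hausdorff_space X.
Hypothesis lX : locally_compact [set: X].
Hypothesis Gk : is_kernel G.
Hypothesis Gc : consistent G.
Implicit Types (phi psi : Cc X R) (mu nu lambda : radon X R).
Implicit Types (f g : X -> \bar R).
Local Notation pot := (potential G).

Lemma consistent_fin lambda mu : Eplus G lambda -> Eplus1 G mu ->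
  exists r : R, Lint mu (pot lambda) = r%:E.
Proof.
move=> El Em; have [h _] := Gc El; move: (h mu Em).
rewrite radon_integralE; last exact: Glsc_potential.
have := energy_ge0 hX lX Gk mu lambda.
by case: (Lint mu _) => [r||] // _ _; exists r.
Qed.

Lemma consistent_nbhs lambda mu (r d : R) : Eplus G lambda -> Eplus1 G mu ->
  Lint mu (pot lambda) = r%:E -> (0 < d)%R ->
  nbhs mu [set nu | Eplus1 G nu -> (r - d)%:E < Lint nu (pot lambda) /\
                                   Lint nu (pot lambda) < (r + d)%:E].
Proof.
move=> El Em rE d0; have [_ /subspace_continuousP/(_ mu Em)] := Gc El.
have E nu : radon_integral nu (pot lambda) = Lint nu (pot lambda).
  by rewrite radon_integralE //; exact: Glsc_potential.
have N : nbhs (r%:E : \bar R) [set y | (r - d)%:E < y /\ y < (r + d)%:E].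
  apply: filterI.
    by apply: (@nbhs_open_ereal_gt _ _ (fun r => r - d)%R); lra.
  by apply: (@nbhs_open_ereal_lt _ _ (fun r => r + d)%R); lra.
have {}N : nbhs (radon_integral mu (pot lambda))
  [set y | (r - d)%:E < y /\ y < (r + d)%:E] by rewrite E rE.
move=> /(_ _ N) h0.
have {}h0 : nbhs mu [set nu | Eplus1 G nu ->
    (r - d)%:E < radon_integral nu (pot lambda) /\
    radon_integral nu (pot lambda) < (r + d)%:E] by exact: h0.
by apply: filterS h0 => nu h Enu; rewrite -E; exact: h.
Qed.

(** Dini's theorem on the vaguely compact energy ball. *)
Lemma potential_dini lambda (e : R) : Eplus G lambda -> (0 < e)%R ->
  exists phi, below phi (pot lambda) /\
    forall mu, Eplus1 G mu -> Lint mu (pot lambda) <= (mu phi + e)%:E.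
Proof.
move=> El e0.
have Gp := Glsc_potential hX lX Gk lambda.
pose P (S : set (radon X R)) := exists phi, below phi (pot lambda) /\
  forall mu, S mu -> Eplus1 G mu -> Lint mu (pot lambda) <= (mu phi + e)%:E.
have [phi [pl h]] : P (Eplus1 G).
  apply: (@compact_induction _ P) (Eplus1_compact hX lX Gk) _.
  - by exists 0%R; split=> // x; split=> //; exact: Glsc_ge0.
  - by move=> A B AB [phi [pl h]]; exists phi; split=> // mu /AB; exact: h.
  - move=> A B [a [al ha]] [b [bl hb]]; have [m [ml mE]] := below_max al bl.
    exists m; split=> // mu [Am|Bm] Em.
      apply: (le_trans (ha mu Am Em)); rewrite lee_fin lerD2r radon_le // => x.
      by rewrite mE le_max lexx.
    apply: (le_trans (hb mu Bm Em)); rewrite lee_fin lerD2r radon_le // => x.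
    by rewrite mE le_max lexx orbT.
  - move=> mu Em; have [r rE] := consistent_fin El Em.
    have : (r - e / 3)%:E < Lint mu (pot lambda) by rewrite rE lte_fin; lra.
    move=> /Lint_gt[phi [pl]]; rewrite lte_fin => hphi.
    have e3 : (0 < e / 3)%R by lra.
    have N1 := consistent_nbhs El Em rE e3.
    have N2 := cvg_eventually_gt (@vague_continuous _ _ phi mu) hphi.
    exists ([set nu | Eplus1 G nu -> (r - e / 3)%:E < Lint nu (pot lambda) /\
                               Lint nu (pot lambda) < (r + e / 3)%:E] `&`
            [set nu : radon X R | (r - e / 3 < nu phi)%R]); first exact: filterI.
    exists phi; split=> // nu [h1 h2] /h1[_ h3]; apply: (le_trans (ltW h3)).
    by move: h2; rewrite lee_fin /=; lra.
by exists phi; split=> // mu Em; exact: h.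
Qed.

(** To integrate only where [g > phi], test the hypothesis on the measures
    [theta * mu], with [theta] vanishing where a given [psi <= (g - phi)^+] is
    small.  Where [theta] does not vanish, [psi + phi] lies below [g]; the
    cut-off [beta], equal to 1 there, turns it into a test function below [g]
    everywhere without changing its integral against [theta * mu]. *)
Lemma Lint_subpos g phi (e : R) : Glsc g -> (forall x, 0 <= phi x)%R ->
  (forall nu, Eplus1 G nu -> Lint nu g <= (nu phi + e)%:E) ->
  forall mu, Eplus1 G mu -> Lint mu (fun x => maxe (g x - (phi x)%:E) 0) <= e%:E.
Proof.
move=> Gg phi0 h mu Emu; apply: Lint_ub => psi pg; rewrite lee_fin.
apply/ler_addgt0Pr => r r0; have [c c0 hc] := radon_le_approx hX lX mu psi r0.
pose d := (c / 2)%R; have d0 : (0 < d)%R by rewrite /d; lra.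
have psi0 x : (0 <= psi x)%R by have [] := pg x.
have [u uE] := @Cc_subpos _ _ psi d (ltW d0).
have [v vE] : exists v : Cc X R, forall x, v x = Num.max (psi x - 2 * d)%R 0%R.
  by apply: Cc_subpos; lra.
have [theta tE] : exists t : Cc X R, forall x, (t x = d^-1 * (u x - v x))%R.
  by exists (d^-1 *: (u - v))%R.
have [beta bE] : exists b : Cc X R, forall x, (b x = d^-1 * (psi x - u x))%R.
  by exists (d^-1 *: (psi - u))%R.
(* theta = min ((psi - d)^+) d / d  and  beta = min psi d / d. *)
have dV z : (0 <= d^-1 * z <= 1)%R = (0 <= z <= d)%R.
  by rewrite pmulr_rge0 ?invr_gt0 // ler_pdivrMl // mulr1.
have t01 x : (0 <= theta x <= 1)%R.
  rewrite tE dV uE vE.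
  by case: (leP (psi x - d)%R 0%R); case: (leP (psi x - 2 * d)%R 0%R); lra.
have b01 x : (0 <= beta x <= 1)%R.
  rewrite bE dV uE; have := psi0 x.
  by case: (leP (psi x - d)%R 0%R); lra.
have tb x : (theta x * beta x = theta x)%R.
  have := psi0 x; rewrite tE bE uE vE.
  case: (leP (psi x - d)%R 0%R) => h1 h2.
    have -> : Num.max (psi x - 2 * d)%R 0%R = 0%R :> R by apply/max_idPr; lra.
    by rewrite subrr mulr0 mul0r.
  have -> : (psi x - (psi x - d) = d)%R by lra.
  by rewrite mulVf ?gt_eqF // mulr1.
have psit x : (psi x <= theta x * psi x + 2 * d)%R.
  have [h1|h1] := lerP (psi x) (2 * d)%R.
    have /andP[t0 _] := t01 x.
    have : (0 <= theta x * psi x)%R by rewrite mulr_ge0.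
    by lra.
  rewrite tE uE vE (max_idPl _) ?(max_idPl _); [|lra|lra].
  have -> : (psi x - d - (psi x - 2 * d) = d)%R by lra.
  by rewrite mulVf ?gt_eqF // mul1r; lra.
have t0 x : (0 <= theta x)%R by have /andP[] := t01 x.
have [nu nuE] := radon_density_ex mu t0.
have numu phi1 : (forall x, 0 <= phi1 x)%R -> (nu phi1 <= mu phi1)%R.
  move=> p0; have [m mE] := Cc_mul phi1 (@Cc_continuous _ _ theta).
  rewrite (nuE phi1 m mE); apply: radon_le => x; rewrite mE ler_piMl //.
  by have /andP[] := t01 x.
have Enu : Eplus1 G nu.
  apply/(Eplus1E hX lX Gk).
  apply: le_trans (Lint_le_measure (pot nu) numu) _.
  rewrite (mutual_energy_sym hX lX Gk).
  apply: le_trans (Lint_le_measure (pot mu) numu) _.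
  exact/(Eplus1E hX lX Gk).
have [alpha aE] := Cc_mul (psi + phi)%R (@Cc_continuous _ _ beta).
have ag : below alpha g.
  move=> x; rewrite aE CcD; have /andP[b0 b1] := b01 x; split.
    by rewrite mulr_ge0 // addr_ge0.
  have [p0|pn0] := eqVneq (psi x) 0%R.
    have -> : beta x = 0%R.
      by rewrite bE uE p0 (max_idPr _) ?subrr ?mulr0 //; lra.
    by rewrite mul0r; exact: Glsc_ge0.
  have pp : (0 < psi x)%R by rewrite lt0r pn0 psi0.
  have [_] := pg x; rewrite le_max lee_fin [(psi x <= 0)%R]leNgt pp orbF.
  rewrite leeBrDr // -EFinD; apply: le_trans; rewrite lee_fin.
  by rewrite ler_piMl // addr_ge0.
have [m mE] := Cc_mul (psi + phi)%R (@Cc_continuous _ _ theta).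
have nuA : nu alpha = (nu psi + nu phi)%R.
  rewrite -radonD (nuE (psi + phi)%R m mE); apply: nuE => x.
  by rewrite mE aE mulrA tb.
have : (nu psi <= e)%R.
  have := le_trans (Lint_ge nu ag) (h nu Enu); rewrite lee_fin nuA; lra.
have [n nE] := Cc_mul psi (@Cc_continuous _ _ theta).
rewrite (nuE psi n nE).
suff : (mu psi <= mu n + r)%R by lra.
apply: hc => x; rewrite nE; first by rewrite mulr_ge0.
by move=> _; have := psit x; rewrite /d; lra.
Qed.

End domination.
(** * Majorants of class Hzero_star *)

Section majorant.
Context {X : topologicalType} {R : realType}.
Variable G : X * X -> \bar R.
Hypothesis hX : hausdorff_space X.
Hypothesis lX : locally_compact [set: X].
Hypothesis Gk : is_kernel G.
Hypothesis Gc : consistent G.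
Implicit Types (phi psi : Cc X R) (mu nu lambda : radon X R).
Implicit Types (f g : X -> \bar R).
Local Notation pot := (potential G).

Lemma Lint_scale_measure mu (rho : radon X R) (c : R) g : (0 <= c)%R -> Fplus g ->
  (forall phi, rho phi = c * mu phi)%R -> Lint rho g = c%:E * Lint mu g.
Proof.
move=> c0 g0 h; rewrite /radon_integral_lsc -ereal_supZl //; last first.
  by apply/set0P; exists (mu 0%R)%:E; exists 0%R => // x; split=> //; exact: g0.
congr ereal_sup; apply/seteqP; split=> [_ [phi pg <-]|_ [_ [phi pg <-] <-]].
  by exists (mu phi)%:E; [exists phi|rewrite h EFinM].
by exists phi => //; rewrite h EFinM.
Qed.

(** The measure [(mu + t nu) / s] is still in the energy ball, because
    [s^2 >= 1 + 2 t J + t^2] bounds the energy of [mu + t nu].  Comparing the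
    integral of [g] against it with [M] and dividing by [t] gives the
    inequality; a defect [t^2] in the choice of [mu] is harmless. *)
Lemma near_maximizer_ineq g mu nu (M J a t : R) : Glsc g ->
  Eplus1 G mu -> Eplus1 G nu -> (0 < t)%R -> (0 <= M)%R ->
  (forall rho, Eplus1 G rho -> Lint rho g <= M%:E) ->
  (M - t ^+ 2)%:E < Lint mu g -> Lint nu g = a%:E -> Lint mu (pot nu) = J%:E ->
  (a <= M * J + t * (M / 2 + 2))%R.
Proof.
move=> Gg Emu Enu t0 M0 hM hmu aE JE.
have J0 : (0 <= J)%R.
  by rewrite -lee_fin -JE; exact: energy_ge0.
pose s := (1 + t * J + t ^+ 2 / 2)%R.
have tJ : (0 <= t * J)%R by rewrite mulr_ge0 // ltW.
have tt : (0 < t ^+ 2)%R by rewrite exprn_gt0.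
have s0 : (0 < s)%R by rewrite /s; lra.
have A0 : (0 <= s^-1)%R by rewrite invr_ge0 ltW.
have B0 : (0 <= t / s)%R by rewrite divr_ge0 ?ltW.
have [rho rhoE] := radon_comb_ex mu nu A0 B0.
have rho_le h := Lint_comb_le h A0 B0 rhoE.
have Lmr : Lint mu (pot rho) <= (s^-1 + t / s * J)%:E.
  rewrite (mutual_energy_sym hX lX Gk); apply: le_trans (rho_le _) _.
  rewrite EFinD; apply: leeD.
    by rewrite -[leRHS]mule1 lee_wpmul2l // ?lee_fin //; exact/(Eplus1E hX lX Gk).
  by rewrite (mutual_energy_sym hX lX Gk) JE.
have Lnr : Lint nu (pot rho) <= (s^-1 * J + t / s)%:E.
  rewrite (mutual_energy_sym hX lX Gk); apply: le_trans (rho_le _) _.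
  rewrite EFinD; apply: leeD; first by rewrite JE.
  by rewrite -[leRHS]mule1 lee_wpmul2l // ?lee_fin //; exact/(Eplus1E hX lX Gk).
have Erho : Eplus1 G rho.
  apply/(Eplus1E hX lX Gk); apply: le_trans (rho_le _) _.
  apply: (@le_trans _ _ (s^-1 * (s^-1 + t / s * J) + t / s * (s^-1 * J + t / s))%:E).
    by rewrite EFinD !EFinM; apply: leeD; apply: lee_wpmul2l;
      rewrite ?lee_fin // -EFinM.
  rewrite lee_fin.
  have -> : (s^-1 * (s^-1 + t / s * J) + t / s * (s^-1 * J + t / s) =
    (1 + 2 * (t * J) + t ^+ 2) / s ^+ 2)%R by field; rewrite gt_eqF.
  rewrite ler_pdivrMr ?exprn_gt0 // mul1r /s.
  have : (0 <= (t * J + t ^+ 2 / 2) ^+ 2)%R by rewrite sqr_ge0.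
  by rewrite !expr2; lra.
have hnu : (a - t)%:E < Lint nu g by rewrite aE lte_fin; lra.
have := le_trans (Lint_comb_gt A0 B0 rhoE hmu hnu) (hM rho Erho).
rewrite lee_fin.
have -> : (s^-1 * (M - t ^+ 2) + t / s * (a - t) = (M - t ^+ 2 + t * (a - t)) / s)%R.
  by field; rewrite gt_eqF.
rewrite ler_pdivrMr // /s => h.
rewrite -(ler_pM2l t0); move: h; rewrite !expr2; lra.
Qed.

(** Take a vague cluster point of the filter of near-maximizers of
    [mu |-> Lint mu g].  The inequality of [near_maximizer_ineq] passes to the
    limit, since it mentions [mu] only through a mutual energy, which consistency
    makes vaguely continuous on the ball. *)
Lemma dominating_measure g : Glsc g ->
  (exists M : R, forall mu, Eplus1 G mu -> Lint mu g <= M%:E) ->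
  exists lambda, Eplus G lambda /\
    forall nu, Eplus1 G nu -> Lint nu g <= Lint nu (pot lambda).
Proof.
move=> Gg [M1 hM1]; have [zeta [Ez zE]] := Eplus1_zero hX lX Gk.
pose S := ereal_sup [set Lint mu g | mu in Eplus1 G].
have S0 : 0 <= S.
  apply: (@le_trans _ _ (Lint zeta g)); first by apply: Lint_ge0; case: Gg.
  by apply: ereal_sup_ubound; exists zeta.
have SM : S <= M1%:E by apply: ge_ereal_sup => _ [mu Em <-]; exact: hM1.
have [M SE] : exists M : R, S = M%:E.
  by move: S0 SM; case: S => [r||] // _ _; exists r.
have M0 : (0 <= M)%R by rewrite -lee_fin -SE.
have hM mu : Eplus1 G mu -> Lint mu g <= M%:E.
  by move=> Em; rewrite -SE; apply: ereal_sup_ubound; exists mu.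
pose F := filter_from [set e : R | (0 < e)%R]
  (fun e => [set mu | Eplus1 G mu /\ (M - e)%:E < Lint mu g]).
have FF : Filter F.
  apply: filter_from_filter; first by exists 1%R => /=.
  move=> e1 e2 /= e10 e20; exists (Num.min e1 e2); first by rewrite /= lt_min e10.
  move=> mu [Em h]; split; split=> //; apply: le_lt_trans h; rewrite lee_fin.
    by rewrite lerD2l lerN2 ge_min lexx.
  by rewrite lerD2l lerN2 ge_min lexx orbT.
have PF : ProperFilter F.
  apply: filter_from_proper => e /= e0.
  have : (M - e)%:E < S by rewrite SE lte_fin; lra.
  by move=> /ereal_sup_gt[_ [mu Em <-] h]; exists mu.
have FE : F (Eplus1 G) by exists 1%R => //= mu [].
have [mu0 [Em0 cl]] := Eplus1_compact hX lX Gk PF FE.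
have [lambda0 l0E] := radon_comb_ex mu0 mu0 M0 (lexx 0%R).
have lE phi : lambda0 phi = (M * mu0 phi)%R by rewrite l0E mul0r addr0.
have Ll f : Fplus f -> Lint lambda0 f = M%:E * Lint mu0 f.
  by move=> f0; exact: Lint_scale_measure.
have p0 lambda : Fplus (pot lambda) := (Glsc_potential hX lX Gk lambda).1.
exists lambda0; split.
  rewrite /Eplus /= (energy_normE hX lX Gk) Ll // (mutual_energy_sym hX lX Gk).
  rewrite Ll //; have := (Eplus1E hX lX Gk mu0).1 Em0.
  have := energy_ge0 hX lX Gk mu0 mu0.
  by case: (Lint mu0 (pot mu0)) => [r||] //; rewrite -!EFinM /= ltry.
move=> nu Enu; have En := Eplus1_Eplus Enu.
have [J0 J0E] := consistent_fin hX lX Gk Gc En Em0.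
rewrite (mutual_energy_sym hX lX Gk) Ll // J0E -EFinM.
have [a aE] : exists a : R, Lint nu g = a%:E.
  have : 0 <= Lint nu g by apply: Lint_ge0; case: Gg.
  by move: (hM nu Enu); case: (Lint nu g) => [r||] // _ _; exists r.
rewrite aE lee_fin; apply/ler_addgt0Pr => e e0.
pose t := (e / 2 / (M / 2 + 2))%R.
have t0 : (0 < t)%R by rewrite !divr_gt0 //; lra.
have tE : (t * (M / 2 + 2) = e / 2)%R by rewrite /t mulfVK // gt_eqF //; lra.
pose d := (e / 2 / (M + 1))%R.
have d0 : (0 < d)%R by rewrite !divr_gt0 //; lra.
have dM : (M * d <= e / 2)%R.
  by rewrite /d mulrCA ler_piMr ?divr_ge0 //; [lra|rewrite ler_pdivrMr; lra].
have N := consistent_nbhs hX lX Gk Gc En Em0 J0E d0.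
have FP : F [set mu | Eplus1 G mu /\ (M - t ^+ 2)%:E < Lint mu g].
  by exists (t ^+ 2)%R => //=; rewrite exprn_gt0.
have [mu [[Emu hmu] /(_ Emu)[_ h]]] := cl _ _ FP N.
have [J JE] := consistent_fin hX lX Gk Gc En Emu.
have := near_maximizer_ineq Gg Emu Enu t0 M0 hM hmu aE JE.
move: h; rewrite JE lte_fin => h h2.
have : (M * J <= M * (J0 + d))%R by rewrite ler_wpM2l // ltW.
by lra.
Qed.

(** The majorant is the maximum of an l.s.c. [g >= f] and of a potential that
    dominates [g] in the integrated sense; a single [phi] below the potential
    approximates both. *)
Lemma Hzero_star_majorant f : outer_cap G f < +oo ->
  exists g, Hzero_star G g /\ fun_le f g.
Proof.
move=> /outer_cap_lt[g [b [Gg fg boo hb]]].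
have [lambda [El hl]] : exists lambda, Eplus G lambda /\
    forall nu, Eplus1 G nu -> Lint nu g <= Lint nu (pot lambda).
  apply: dominating_measure => //.
  have [zeta [Ez zE]] := Eplus1_zero hX lX Gk.
  have := hb zeta Ez; have : 0 <= Lint zeta g by apply: Lint_ge0; case: Gg.
  move=> h1 /(le_trans h1); case: b boo hb {h1} => [r||] // _ hb _.
  by exists r.
have Gp := Glsc_potential hX lX Gk lambda.
exists (fun x => maxe (g x) (pot lambda x)); split; last first.
  by move=> x; rewrite le_max fg.
apply/(Hzero_starP hX lX Gk); first exact: (Glsc_max Gg Gp).1.
move=> e e0; have e3 : (0 < e / 3)%R by lra.
have [phi [pl hphi]] := potential_dini hX lX Gk Gc El e3.
have phi0 x : (0 <= phi x)%R by have [] := pl x.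
exists (fun x => (phi x)%:E); split; first exact: Hzero_Cc.
  by move=> x; rewrite le_max; have [_ ->] := pl x; rewrite orbT.
have h1 nu : Eplus1 G nu -> Lint nu g <= (nu phi + e / 3)%:E.
  by move=> En; apply: le_trans (hl nu En) (hphi nu En).
have k1 := Lint_subpos hX lX Gk Gg phi0 h1.
have k2 := Lint_subpos hX lX Gk Gp phi0 hphi.
have G1 := Glsc_subpos phi Gg; have G2 := Glsc_subpos phi Gp.
apply: (@le_lt_trans _ _ (e / 3 + e / 3)%:E); last by rewrite lte_fin; lra.
apply: (outer_cap_le (GlscD G1 G2)) => [x|mu Em].
  have a1 : 0 <= maxe (g x - (phi x)%:E) 0 by rewrite le_max lexx orbT.
  have a2 : 0 <= maxe (pot lambda x - (phi x)%:E) 0 by rewrite le_max lexx orbT.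
  case: (leP (g x) (pot lambda x)) => _.
    by rewrite -[leLHS]add0e leeD // le_max lexx.
  by rewrite -[leLHS]adde0 leeD // le_max lexx.
apply: (le_trans (Lint_add hX lX mu G1 G2)); rewrite EFinD.
by apply: leeD; [exact: k1|exact: k2].
Qed.

End majorant.
(** * Quasi u.s.c. functions and quasicompact sets *)

Section conclusion.
Context {X : topologicalType} {R : realType}.
Variable G : X * X -> \bar R.
Hypothesis hX : hausdorff_space X.
Hypothesis lX : locally_compact [set: X].
Hypothesis Gk : is_kernel G.
Implicit Types (f g h : X -> \bar R) (A V : set X).

Lemma Hzero_bounded h : Hzero h ->
  exists M : R, (0 < M)%R /\ forall x, h x <= M%:E.
Proof.
move=> [h0 hfin husc hK].
pose P A := exists M : R, (0 < M)%R /\ forall x, A x -> h x <= M%:E.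
have [M [M0 hM]] : P (closed_support h).
  apply: (@compact_induction _ P) hK _.
  - by exists 1%R.
  - by move=> A B AB [M [M0 hM]]; exists M; split=> // x /AB /hM.
  - move=> A B [M [M0 hM]] [N [N0 hN]]; exists (M + N)%R; split.
      exact: addr_gt0.
    by move=> x [/hM|/hN] h1; apply: (le_trans h1); rewrite lee_fin; lra.
  - move=> x _; have [r [r0 rE]] : exists r : R, (0 <= r)%R /\ h x = r%:E.
      by have := h0 x; have := hfin x; case: (h x) => [r||] // _ r0; exists r.
    have [|V Vx hV] := husc x (r + 1)%R; first by rewrite rE lte_fin; lra.
    by exists V => //; exists (r + 1)%R; split=> [|y /hV /ltW //]; lra.
exists M; split=> // x; have [->|hx] := eqVneq (h x) 0.
  by rewrite lee_fin ltW.
by apply: hM; exact: subset_closure.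
Qed.

(** The factor 2 is the price of the threshold 1/2, which makes the superlevel
    set of an l.s.c. [g >= 1_A] contain [A]. *)
Lemma outer_cap_set_open A (e : R) : outer_cap_set G A < e%:E ->
  exists V, [/\ open V, A `<=` V & outer_cap_set G V < (2 * e)%:E].
Proof.
move=> /outer_cap_lt[g [b [Gg Ag be hb]]].
exists [set x | (1 / 2 : R)%:E < g x]; split.
- by have /lower_semicontinuousP := Gg.2; exact.
- move=> x Ax /=; have := Ag x; rewrite indicE mem_set // => /lt_le_trans; apply.
  by rewrite lte_fin /=; lra.
- apply: (@outer_cap_scale _ _ G _ g) => //.
    move=> x; rewrite indicE; case: (boolP (x \in _)) => [|_].
      rewrite inE /= => h; rewrite -lee_pdivrMl // mule1; apply: le_trans (ltW h).
      by rewrite lee_fin; lra.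
    by rewrite mule_ge0 //; exact: Glsc_ge0.
  by apply: le_lt_trans be; exact: (outer_cap_le Gg).
Qed.

(** With [h = min f h0] off [V] and [h = 0] on [V], the difference [f - h] is
    at most [g - h0] off [V] and at most [(g - h0) + M] on [V], where [M] bounds
    [h0]; so [V] is chosen after [h0]. *)
Lemma quasi_usc_Hzero_star f g : Fplus f -> quasi_usc G f -> Hzero_star G g ->
  fun_le f g -> Hzero_star G f.
Proof.
move=> f0 qf sg fg; apply/(Hzero_starP hX lX Gk f0) => e e0.
have g0 : Fplus g by case: sg.
have e3 : (0 < e / 3)%R by lra.
have [h0 [Hh0 h0g ch0]] := (Hzero_starP hX lX Gk g0).1 sg _ e3.
have [M [M0 hM]] := Hzero_bounded Hh0.
have e1 : (0 < e / (6 * M))%R by rewrite divr_gt0 // mulr_gt0.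
have [V0 [cV0 fusc]] := qf _ e1.
have [V [oV V0V cV]] := outer_cap_set_open cV0.
have [hp hfin husc hK] := Hh0.
pose h x : \bar R := if x \in V then 0 else mine (f x) (h0 x).
have hin x : V x -> h x = 0 by move=> Vx; rewrite /h mem_set.
have hout x : ~ V x -> h x = mine (f x) (h0 x) by move=> Vx; rewrite /h memNset.
have hh0 x : h x <= h0 x.
  have [Vx|Vx] := pselect (V x); first by rewrite hin //; exact: hp.
  by rewrite hout // ge_min lexx orbT.
have hf x : h x <= f x.
  have [Vx|Vx] := pselect (V x); first by rewrite hin //; exact: f0.
  by rewrite hout // ge_min lexx.
have hge0 x : 0 <= h x.
  have [Vx|Vx] := pselect (V x); first by rewrite hin.
  by rewrite hout // le_min; apply/andP; split; [exact: f0|exact: hp].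
have hH : Hzero h.
  split=> //.
  - by move=> x; apply: le_lt_trans (hfin x).
  - move=> x a ha; have [Vx|Vx] := pselect (V x).
      exists V; first exact: open_nbhs_nbhs.
      by move=> y Vy; rewrite hin //; move: ha; rewrite hin.
    have a0 := le_lt_trans (hge0 x) ha.
    move: ha; rewrite hout // gt_min => /orP[fa|ha].
      have [W Wx hW] := fusc x a fa.
      have V0x : (~` V0) x by move=> /V0V.
      move: Wx; rewrite /nbhs /= -nbhs_subspace_in // => Wx.
      exists [set y | (~` V0) y -> W y] => // y hy.
      have [Vy|Vy] := pselect (V y); first by rewrite hin.
      by rewrite hout // gt_min hW //; apply: hy => /V0V.
    have [W Wx hW] := husc x a ha.
    by exists W => // y /hW; apply: le_lt_trans.
  - apply: (subclosed_compact _ hK); first exact: closed_closure.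
    apply: closure_subset => x /=; apply: contra => /eqP h0x.
    by rewrite eq_le hge0 andbT -h0x hh0.
exists h; split=> //.
have -> : e = (e / 3 + (e / 3 + M * (2 * (e / (6 * M)))))%R.
  by field; rewrite gt_eqF.
apply: (outer_cap_add hX lX (f1 := fun x => g x - h0 x)
  (f2 := fun x => (g x - h0 x) + M%:E * (\1_V x)%:E)) => //; last first.
  apply: (outer_cap_add hX lX (f1 := fun x => g x - h0 x)
    (f2 := fun x => M%:E * (\1_V x)%:E)) => //.
  exact: (@outer_cap_scale _ _ G _ (fun x => (\1_V x)%:E)).
move=> x.
have [r rE] : exists r : R, h0 x = r%:E.
  by have := hp x; have := hfin x; case: (h0 x) => [r||] // _ _; exists r.
have gh : 0 <= g x - h0 x by rewrite rE sube_ge0 // -rE.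
have [Vx|Vx] := pselect (V x).
  rewrite hin // sube0 indicE mem_set // mule1.
  rewrite -[leLHS]add0e; apply: leeD => //.
  apply: (le_trans (fg x)); rewrite -[leLHS](@subeK _ _ (r%:E)) //.
  by rewrite rE leeD2l // -rE.
rewrite hout // indicE memNset // mule0 adde0.
rewrite -[leLHS]adde0; apply: leeD => //.
case: (leP (f x) (h0 x)) => [fh|fh].
  rewrite subee //.
  by move: fh (f0 x); rewrite rE; case: (f x).
by rewrite leeD2r.
Qed.

(** Countable subadditivity, in the form of an l.s.c. common majorant: the sum
    of the series. *)
Lemma outer_cap_countable (u : nat -> X -> \bar R) (e : R) : (0 < e)%R ->
  (forall n, Glsc (u n)) ->
  (forall n mu, Eplus1 G mu -> Lint mu (u n) <= (e * (1 / 2) ^+ n.+1)%:E) ->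
  exists S, [/\ Glsc S, forall n, fun_le (u n) S &
    forall mu, Eplus1 G mu -> Lint mu S <= e%:E].
Proof.
move=> e0 Gu hu; pose T n x : \bar R := \sum_(k < n) u k x.
have TS n x : T n.+1 x = T n x + u n x by rewrite /T big_ord_recr.
have GT n : Glsc (T n).
  elim: n => [|n IH].
    have T0 x : T 0%N x = 0 by rewrite /T big_ord0.
    split=> [x|x a]; rewrite T0 // => a0.
    by exists setT => [|y _]; [exact: filterT|rewrite T0].
  rewrite (_ : T n.+1 = (fun x => T n x + u n x)); first exact: GlscD.
  by apply/funext => x; rewrite TS.
have Tle n : fun_le (T n) (T n.+1).
  by move=> x; rewrite TS leeDl //; exact: Glsc_ge0.
exists (fun x => ereal_sup [set T n x | n in setT]); split.
- by apply: Glsc_sup => //; exists 0%N.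
- move=> n x; apply: (@le_trans _ _ (T n.+1 x)).
    by rewrite TS leeDr //; exact: Glsc_ge0.
  by apply: ereal_sup_ubound; exists n.+1.
- move=> mu Em; apply: (Lint_sup_nat hX lX) => //.
    move=> n m; elim: m => [|m IH]; first by rewrite leqn0 => /eqP -> x.
    rewrite leq_eqVlt => /orP[/eqP -> x //|/IH h x].
    exact: le_trans (h x) (Tle m x).
  move=> n; apply: (@le_trans _ _ (e * (1 - (1 / 2) ^+ n))%:E); last first.
    rewrite lee_fin; have : (0 <= (1 / 2 : R) ^+ n)%R by rewrite exprn_ge0.
    by nra.
  elim: n => [|n IH].
    rewrite expr0 subrr mulr0; apply: Lint_ub => phi pg.
    rewrite -(radon0 mu) lee_fin; apply: radon_le => x.
    by have [_] := pg x; rewrite /T big_ord0 lee_fin.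
  rewrite (_ : T n.+1 = (fun x => T n x + u n x)); last first.
    by apply/funext => x; rewrite TS.
  apply: (le_trans (Lint_add hX lX mu (GT n) (Gu n))).
  apply: (le_trans (leeD IH (hu n mu Em))); rewrite -EFinD lee_fin exprS.
  by lra.
Qed.

(** Choose [h_n] in [Hzero] below [g] and l.s.c. [u_n >= 2^n (g - h_n)] with
    summable small capacities, and let [S] majorize all the [u_n].  On the
    closed set [{S <= 1}] one has [g - h_n <= 2^-n] for all [n], so there
    [g >= 1] amounts to [h_n >= 1 - 2^-n] for all [n], a closed condition whose
    case [n = 1] forces [x] into the support of [h_1]. *)
Lemma superlevel_quasicompact g : Hzero_star G g ->
  quasicompact G [set x | 1 <= g x].
Proof.
move=> sg; have g0 : Fplus g by case: sg.
apply/(quasicompactP hX lX Gk) => e e0.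
have half n : (0 < (1 / 2 : R) ^+ n)%R by rewrite exprn_gt0.
(* One factor 2^-n pays for the multiplication by 2^n in u, the other sums. *)
pose c n := (e / 2 * (1 / 2) ^+ n.+1 * (1 / 2) ^+ n)%R.
have c0 n : (0 < c n)%R by rewrite /c !mulr_gt0 //; lra.
have /choice[hu hhu] : forall n, exists hu : (X -> \bar R) * (X -> \bar R),
    [/\ Hzero hu.1, fun_le hu.1 g, Glsc hu.2, forall x, g x - hu.1 x <= hu.2 x &
      forall mu, Eplus1 G mu -> Lint mu hu.2 <= (c n)%:E].
  move=> n; have [h [Hh hg ch]] := (Hzero_starP hX lX Gk g0).1 sg _ (c0 n).
  have [u [b [Gu hu be hb]]] := outer_cap_lt ch.
  exists (h, u); split=> // mu Em; exact: le_trans (hb mu Em) (ltW be).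
pose u n x := (2 ^+ n)%:E * (hu n).2 x.
have two n : (0 < (2 : R) ^+ n)%R by rewrite exprn_gt0.
have th n : ((2 : R) ^+ n * (1 / 2) ^+ n = 1)%R.
  by rewrite -exprMn mul1r mulfV // expr1n.
have Gu n : Glsc (u n) by have [_ _ Gu _ _] := hhu n; exact: GlscZ.
have [|n mu Em|S [GS uS hS]] := @outer_cap_countable u (e / 2)%R _ Gu; first lra.
  have [_ _ _ _ hm] := hhu n.
  apply: (le_trans (Lint_scale mu _ (two n))).
  apply: (@le_trans _ _ ((2 ^+ n)%:E * (c n)%:E)).
    by rewrite lee_pmul2l ?hm.
  by rewrite -EFinM lee_fin /c mulrCA th mulr1.
pose K := [set x | S x <= 1] `&`
  [set x | forall n, (1 - (1 / 2) ^+ n)%:E <= (hu n).1 x].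
exists K; split.
- have [[hp hfin husc hK] _ _ _ _] := hhu 1%N.
  apply: (subclosed_compact _ hK).
    apply: closedI.
      rewrite (_ : [set x | S x <= 1] = ~` [set x | 1%:E < S x]).
        by apply: open_closedC; have /lower_semicontinuousP := GS.2; exact.
      by apply/seteqP; split=> x /=; rewrite leNgt => /negP.
    rewrite (_ : [set x | _] = \bigcap_n ~` [set x | (hu n).1 x < (1 - (1 / 2) ^+ n)%:E]).
      apply: closed_bigI => n _; apply: open_closedC.
      have [[_ _ usc _] _ _ _ _] := hhu n.
      rewrite openE => x /= /usc[V Vx hV]; exact: filterS hV Vx.
    apply/seteqP; split=> x /= h n; first by move=> _ /=; rewrite ltNge h.
    by have /= := h n I; rewrite ltNge => /negP; rewrite negbK.
  move=> x [_ /(_ 1%N)]; rewrite expr1 => h; apply: subset_closure => /=.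
  by rewrite gt_eqF // (lt_le_trans _ h) // lte_fin; lra.
- move=> x [_ h] /=; apply/lee_addgt0Pr => d d0.
  have [n hn] : exists n, ((1 / 2 : R) ^+ n < d)%R.
    pose n := (Num.truncn d^-1).+1; exists n.
    have : (d^-1 < 2 ^+ n)%R.
      apply: lt_trans (truncnS_gt _) _.
      by rewrite -natrX ltr_nat ltn_expl.
    rewrite -(ltr_pM2l (half n)) [((1 / 2) ^+ n * 2 ^+ n)%R]mulrC th.
    by rewrite ltr_pdivrMr // [ltRHS]mul1r.
  have [_ hg _ _ _] := hhu n.
  apply: (@le_trans _ _ ((hu n).1 x + d%:E)); last by rewrite leeD2r.
  apply: (@le_trans _ _ ((1 - (1 / 2) ^+ n)%:E + d%:E)); last by rewrite leeD2r.
  by rewrite -EFinD lee_fin; lra.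
- apply: (@le_lt_trans _ _ (e / 2)%:E); last by rewrite lte_fin; lra.
  apply: (outer_cap_le GS _ hS) => x; rewrite indicE.
  case: (boolP (x \in _)) => [|_]; last exact: Glsc_ge0.
  rewrite inE /= => -[gx nK]; rewrite leNgt; apply/negP => Sx; apply: nK.
  split; first exact: ltW.
  move=> n /=; have [[hp hfin _ _] hg _ hle _] := hhu n.
  have un : (hu n).2 x <= ((1 / 2) ^+ n)%:E.
    rewrite -(@lee_pmul2l _ (2 ^+ n)%:E) ?lte_fin // -EFinM th.
    exact: le_trans (uS n x) (ltW Sx).
  have := le_trans (hle x) un; have := hp x; have := hfin x.
  case: ((hu n).1 x) => [r||] // _ _; rewrite leeBlDr // => h.
  by have := le_trans gx h; rewrite -EFinD !lee_fin; lra.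
Qed.

Lemma quasiclosed_quasicompact A B : quasicompact G B -> A `<=` B ->
  quasiclosed G A -> quasicompact G A.
Proof.
move=> /(quasicompactP hX lX Gk) qB AB /(quasiclosedP hX lX Gk) qA.
apply/(quasicompactP hX lX Gk) => e e0; have e2 : (0 < e / 2)%R by lra.
have [K [cK KB hK]] := qB _ e2; have [F [cF FA hF]] := qA _ e2.
exists (K `&` F); split.
- exact: compact_closedI.
- by move=> x [_ /FA].
- have -> : e = (e / 2 + e / 2)%R by lra.
  apply: outer_cap_add hK hF => // x; rewrite -EFinD lee_fin !indicE.
  case: (boolP (x \in A `\` _)); last by rewrite addr_ge0.
  rewrite inE => -[Ax nKF].
  have [Fx|nFx] := pselect (F x).
    by rewrite [x \in B `\` K]mem_set ?lerDl //; split; [exact: AB|move=> Kx; exact: nKF].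
  by rewrite [x \in A `\` F]mem_set ?lerDr.
Qed.

End conclusion.

Local Close Scope ereal_scope.
Local Close Scope ring_scope.
Local Close Scope classical_set_scope.

Theorem lemma3p14 (R : realType) (X : topologicalType)
    (X_nonempty : ([set: X] !=set0)%classic)
    (X_hausdorff : hausdorff_space X)
    (X_locally_compact : locally_compact [set: X]%classic)
    (G : X * X -> \bar R) (G_kernel : is_kernel G)
    (G_consistent : consistent G) (G_posdef : positive_definite G) :
  (forall f : X -> \bar R, Fplus f -> (outer_cap G f < +oo)%E ->
     (exists g : X -> \bar R, Hzero_star G g /\ fun_le f g) /\
     (quasi_usc G f -> Hzero_star G f)) /\
  (forall A : set X, (outer_cap_set G A < +oo)%E ->
     (exists B : set X, quasicompact G B /\ (A `<=` B)%classic) /\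
     (quasiclosed G A -> quasicompact G A)).
Proof.
have maj := Hzero_star_majorant X_hausdorff X_locally_compact G_kernel
  G_consistent.
split=> [f f0 cf|A cA].
  have [g [sg fg]] := maj f cf; split; first by exists g.
  move=> qf.
  exact: (quasi_usc_Hzero_star X_hausdorff X_locally_compact G_kernel f0 qf sg).
have [B [qB AB]] : exists B : set X, quasicompact G B /\ (A `<=` B)%classic.
  have [g [sg fg]] := maj _ cA; exists [set x | (1 <= g x)%E]%classic; split.
    exact: (superlevel_quasicompact X_hausdorff X_locally_compact G_kernel sg).
  by move=> x Ax /=; have := fg x; rewrite indicE mem_set.
split; first by exists B.
exact: (quasiclosed_quasicompact X_hausdorff X_locally_compact G_kernel qB AB).
Qed.
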